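(* Let $f=\frac1n\sum_{k=1}^n f_k$ satisfy (A1)–(A4) of the context, let $(\mathbf x_i^t)$ be the iterates produced by running SHAdaGrad (described in the context) for $T\ge 1$ epochs with $m$ iterations per epoch, constant step size $\eta>0$ and scaling parameter $\Gamma$, and suppose that (B) of the context holds along the run. Suppose $\eta\le \frac{c_\sigma^2}{16nLG}$, $\Gamma\ge m$, and $$\delta_{j,i}=\sum_{p=1}^{i-1}\sum_{q=1}^m\left\|\nabla f_{\mathbb B_q^p}(\mathbf x_q^p)\right\|^2+\sum_{q=1}^j\left\|\nabla f_{\mathbb B_q^i}(\mathbf x_q^i)\right\|^2\qquad (1\le i\le T,\ 1\le j\le m).$$ Then there are constants $C_0,C_1,\dots,C_5$, independent of $T$ (depending only on $n,m,d,\Gamma,L,G,c_\sigma,c_\kappa$ and $\Delta$), such that $$\mathbb E_t\left[\left\|\nabla f(\mathbf x_1^t)\right\|\right]\le \frac{C_0}{\eta\sqrt T}+\frac{C_1}{\sqrt T}+\frac{C_2\,\eta}{\sqrt T}+\frac{C_3\,\eta^2}{\sqrt T}+\frac{C_4\ln T}{\sqrt T}+\frac{C_5\,\eta\ln T}{\sqrt T},$$ where $\mathbb E_t$ is the expectation over an index $t\in\{1,\dots,T\}$ drawn with probability proportional to $t^{-1/2}$, i.e. $$\mathbb E_t\left[\|\nabla f(\mathbf x_1^t)\|\right]=\frac{\sum_{i=1}^T i^{-1/2}\,\|\nabla f(\mathbf x_1^i)\|}{\sum_{i=1}^T i^{-1/2}}.$$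
   Context: Problem. $f_1,\dots,f_n:\mathbb R^d\to\mathbb R$ are differentiable, possibly non-convex, $f=\frac1n\sum_{k=1}^n f_k$, and $\|\cdot\|$ is the Euclidean norm. For a nonempty $\mathbb B\subseteq\{1,\dots,n\}$, $\nabla f_{\mathbb B}(\mathbf x)=\frac1{|\mathbb B|}\sum_{k\in\mathbb B}\nabla f_k(\mathbf x)$. Assumptions, with constants $L,G,c_\sigma>0$: (A1) $\Delta:=f(\mathbf x_1^1)-f^*<\infty$, where $f^*=\inf_{\mathbf x}f(\mathbf x)$. (A2) $\|\nabla f_k(\mathbf x)-\nabla f_k(\mathbf y)\|\le L\|\mathbf x-\mathbf y\|$ for all $\mathbf x,\mathbf y\in\mathbb R^d$ and all $k$. (A3) For every $\mathbf x\in\mathbb R^d$, $\frac1n\sum_{k=1}^n\|\nabla f_k(\mathbf x)-\nabla f(\mathbf x)\|^2\ge c_\sigma^2$. (A4) $\|\nabla f_k(\mathbf x)\|\le G$ for all $\mathbf x$ and all $k$. Iteration. $\mathbf x_j^i$ is the parameter at the $j$-th iteration of the $i$-th epoch. In epoch $t$ the index set $\{1,\dots,n\}$ is partitioned into $m$ mini-batches $\mathbb B_1^t,\dots,\mathbb B_m^t$ of equal size $n/m$. Put $$\mathbf H_{i,t}=[\nabla f_{\mathbb B_1^t}(\mathbf x_1^t),\dots,\nabla f_{\mathbb B_i^t}(\mathbf x_i^t)]\in\mathbb R^{d\times i},\qquad \mathbf G_{i,t}=\sum_{\tau=1}^{t-1}\mathbf H_{m,\tau}\mathbf H_{m,\tau}^\top+\mathbf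 H_{i,t}\mathbf H_{i,t}^\top+\frac{\delta_{i,t}}{\Gamma}\mathbf I,$$ where $\delta_{i,t}\ge 0$ is the perturbation and $\Gamma>0$ a scaling hyper-parameter; the matrices $\mathbf G_{i,t}$ are assumed positive definite. The update is $\mathbf x_{i+1}^t=\mathbf x_i^t-\eta\,\mathbf G_{i,t}^{-1/2}\nabla f_{\mathbb B_i^t}(\mathbf x_i^t)$ for $1\le i\le m$, and $\mathbf x_1^{t+1}=\mathbf x_{m+1}^t$. SHAdaGrad. The iteration $\mathbf x_{i+1}^t=\mathbf x_i^t-\eta\,\mathbf G_{i,t}^{-1/2}\nabla f_{\mathbb B_i^t}(\mathbf x_i^t)$ for $1\le i\le m$, $\mathbf x_1^{t+1}=\mathbf x_{m+1}^t$, with $\mathbf G_{i,t}=\sum_{\tau=1}^{t-1}\mathbf H_{m,\tau}\mathbf H_{m,\tau}^\top+\mathbf H_{i,t}\mathbf H_{i,t}^\top+\frac{\delta_{i,t}}{\Gamma}\mathbf I$, where, at the start of each epoch $t$, the instances are randomly shuffled and partitioned into $m$ equal mini-batches, and the shuffling is repeated until $\sum_{j=1}^m\|\nabla f_{\mathbb B_j^t}(\mathbf x_1^t)\|^2\ge\frac{c_\sigma^2m^2}{8n}$; the accepted partition is the one used in the epoch. (B) For every epoch $t$, $\mathbf H_{m,t}$ has full column rank (so $d\ge m$) and $\lambda_{\max}(\mathbf H_{m,t}^\top\mathbf H_{m,t})/\lambda_{\min}(\mathbf H_{m,t}^\top\mathbf H_{m,t})\le c_\kappa$, where $\lambda_{\max},\lambda_{\min}$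 are the largest and smallest singular values. *)

(* Defs.v *)
From HB Require Import structures.
From mathcomp Require Import all_boot all_order all_algebra.
From mathcomp Require Import all_classical all_reals all_analysis.

Set Implicit Arguments.
Unset Strict Implicit.
Unset Printing Implicit Defensive.

Import Order.TTheory GRing.Theory Num.Theory.
Import numFieldNormedType.Exports.
Local Open Scope classical_set_scope.
Local Open Scope ring_scope.

(* The norm carried by ['cV[R]_d] in the library is the max norm, so the
   Euclidean norm is defined separately.  Both induce the same topology, hence
   the same notion of differentiability. *)
Definition l2norm (R : realType) (d : nat) (v : 'cV[R]_d) : R :=
  Num.sqrt (\sum_(i < d) v i 0 ^+ 2).

Definition grad (R : realType) (d : nat) (f : 'cV[R]_d -> R) (x : 'cV[R]_d) :
    'cV[R]_d :=
  \col_(i < d) 'D_(delta_mx i 0) f x.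

Definition mean_fun (R : realType) (d n : nat) (f : 'I_n -> 'cV[R]_d -> R)
    (x : 'cV[R]_d) : R :=
  n%:R^-1 * \sum_(k < n) f k x.

Definition batch_grad (R : realType) (d n : nat) (f : 'I_n -> 'cV[R]_d -> R)
    (B : {set 'I_n}) (x : 'cV[R]_d) : 'cV[R]_d :=
  #|B|%:R^-1 *: \sum_(k in B) grad (f k) x.

Definition posdefmx (R : realType) (d : nat) (A : 'M[R]_d) : Prop :=
  A^T = A /\ forall v : 'cV[R]_d, v != 0 -> 0 < (v^T *m A *m v) 0 0.

(* [A^{-1/2}]: the positive definite square root of the inverse of [A].  It
   exists and is unique when [A] is positive definite; the default value [0]
   is only relevant for other matrices. *)
Definition invsqrtmx (R : realType) (d : nat) (A : 'M[R]_d) : 'M[R]_d :=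
  xget 0 [set S : 'M[R]_d | posdefmx S /\ S *m S = invmx A].

Definition singular_values (R : realType) (m n : nat) (A : 'M[R]_(m, n)) :
    set R :=
  [set s : R | 0 <= s /\ eigenvalue (A^T *m A) (s ^+ 2)].

Definition max_singular_value (R : realType) (m n : nat) (A : 'M[R]_(m, n)) : R :=
  sup (singular_values A).

Definition min_singular_value (R : realType) (m n : nat) (A : 'M[R]_(m, n)) : R :=
  inf (singular_values A).

(* Everywhere below, epochs and iterations are numbered from 1: [x t i] is the
   parameter at iteration [i] of epoch [t], and [B t i] is the mini-batch used
   there, for [1 <= t] and [1 <= i <= m].  Values at index 0 are never used. *)

Definition equal_batches (n m : nat) (B : nat -> {set 'I_n}) : Prop :=
  [/\ finset.partition [set B (nat_of_ord j).+1 | j : 'I_m]%SET [set: 'I_n]%SET,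
      injective (fun j : 'I_m => B j.+1)
    & forall j : 'I_m, (#|B j.+1| * m)%N = n].

Definition step_grad (R : realType) (d n : nat) (f : 'I_n -> 'cV[R]_d -> R)
    (B : nat -> nat -> {set 'I_n}) (x : nat -> nat -> 'cV[R]_d) (t i : nat) :
    'cV[R]_d :=
  batch_grad f (B t i) (x t i).

(* [H_{i,t}]; its column [j : 'I_i] is the gradient of iteration [j + 1]. *)
Definition Hmx (R : realType) (d n : nat) (f : 'I_n -> 'cV[R]_d -> R)
    (B : nat -> nat -> {set 'I_n}) (x : nat -> nat -> 'cV[R]_d) (t i : nat) :
    'M[R]_(d, i) :=
  \matrix_(k < d, j < i) step_grad f B x t j.+1 k 0.

(* [G_{i,t}] *)
Definition Gmx (R : realType) (d n m : nat) (f : 'I_n -> 'cV[R]_d -> R)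
    (B : nat -> nat -> {set 'I_n}) (x : nat -> nat -> 'cV[R]_d)
    (Gamma : R) (delta : nat -> nat -> R) (t i : nat) : 'M[R]_d :=
  \sum_(1 <= s < t) Hmx f B x s m *m (Hmx f B x s m)^T
  + Hmx f B x t i *m (Hmx f B x t i)^T + (delta t i / Gamma)%:M.

(* [T] epochs of SHAdaGrad.  The random shuffling enters only through the
   accepted partitions [B t], so a run is any sequence of partitions passing
   the acceptance test, together with the iterates that it generates. *)
Record shadagrad_run (R : realType) (d n m : nat) (f : 'I_n -> 'cV[R]_d -> R)
    (csigma eta Gamma : R) (delta : nat -> nat -> R) (T : nat)
    (B : nat -> nat -> {set 'I_n}) (x : nat -> nat -> 'cV[R]_d) : Prop := {
  run_batches : forall t, (1 <= t <= T)%N -> equal_batches m (B t);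
  run_accepted : forall t, (1 <= t <= T)%N ->
    csigma ^+ 2 * m%:R ^+ 2 / (8 * n%:R) <=
      \sum_(1 <= j < m.+1) l2norm (batch_grad f (B t j) (x t 1%N)) ^+ 2;
  run_delta_ge0 : forall t i, (1 <= t <= T)%N -> (1 <= i <= m)%N ->
    0 <= delta t i;
  run_posdef : forall t i, (1 <= t <= T)%N -> (1 <= i <= m)%N ->
    posdefmx (Gmx m f B x Gamma delta t i);
  run_step : forall t i, (1 <= t <= T)%N -> (1 <= i <= m)%N ->
    x t i.+1 = x t i -
      eta *: (invsqrtmx (Gmx m f B x Gamma delta t i) *m step_grad f B x t i);
  run_epoch : forall t, (1 <= t <= T)%N -> x t.+1 1%N = x t m.+1
}.

(* Expectation of [u t] when [t] is drawn from [{1, ..., T}] with probability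
   proportional to [t^{-1/2}]. *)
Definition epoch_expectation (R : realType) (T : nat) (u : nat -> R) : R :=
  (\sum_(1 <= i < T.+1) i%:R `^ (- 2^-1) * u i) /
  (\sum_(1 <= i < T.+1) i%:R `^ (- 2^-1)).

(* Main.v *)
Require Import Defs.
From HB Require Import structures.
From mathcomp Require Import all_boot all_order all_algebra.
From mathcomp Require Import all_classical all_reals all_analysis.
From mathcomp Require Import ring lra.

Set Implicit Arguments.
Unset Strict Implicit.
Unset Printing Implicit Defensive.

Import Order.TTheory GRing.Theory Num.Theory.
Import numFieldNormedType.Exports.
Local Open Scope classical_set_scope.
Local Open Scope ring_scope.

(* Since [delta] is the trace of the gradient part of [G_{i,t}], that matrix
   lies between [delta / Gamma] and [(1 + 1 / Gamma) delta].  As [G_{i,t}]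
   dominates the outer square of the current gradient, every step has length at
   most [eta]; so the acceptance test at [x_1^t] survives along the epoch, each
   epoch adds at least [a = csigma^2 m^2 / (16 n)] to [delta], and the step
   matrices [G_{i,t}^{-1/2}] are of exact order [t^{-1/2}].  Within an epoch
   they vary by [O(1/t)] (Sylvester's equation), hence one epoch is, up to
   [O(eta / t)], a gradient step of length of order [eta / sqrt t] for [f],
   which decreases [f] by order [eta |grad f(x_1^t)|^2 / sqrt t].

   The first power of the gradient norm comes from (B): the smallest eigenvalue
   of [H^T H] is comparable to its trace, hence bounded below, so the epoch sum
   [H 1] of the gradients is bounded below and so is
   [|grad f(x_1^t)| >= b - O(1 / sqrt t)].  Summing over [t >= 2] telescopes
   [f] and leaves a harmonic sum; epoch 1 is bounded trivially. *)

(** * Euclidean inner product *)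

Definition dotv (R : realType) (d : nat) (u v : 'cV[R]_d) : R :=
  (u^T *m v) 0 0.

Section DotProduct.
Variables (R : realType) (d : nat).
Implicit Types (u v w : 'cV[R]_d) (A S : 'M[R]_d) (a c : R).

Lemma dotvE u v : dotv u v = \sum_(i < d) u i 0 * v i 0.
Proof. by rewrite /dotv mxE; apply: eq_bigr => i _; rewrite !mxE. Qed.

Lemma dotvC u v : dotv u v = dotv v u.
Proof. by rewrite !dotvE; apply: eq_bigr => i _; rewrite mulrC. Qed.

Lemma dotvDr u v w : dotv u (v + w) = dotv u v + dotv u w.
Proof. by rewrite /dotv mulmxDr mxE. Qed.

Lemma dotvDl u v w : dotv (v + w) u = dotv v u + dotv w u.
Proof. by rewrite dotvC dotvDr !(dotvC u). Qed.

Lemma dotvZr a u v : dotv u (a *: v) = a * dotv u v.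
Proof. by rewrite /dotv -scalemxAr mxE. Qed.

Lemma dotvZl a u v : dotv (a *: u) v = a * dotv u v.
Proof. by rewrite dotvC dotvZr dotvC. Qed.

Lemma dotvNr u v : dotv u (- v) = - dotv u v.
Proof. by rewrite -scaleN1r dotvZr mulN1r. Qed.

Lemma dotvNl u v : dotv (- u) v = - dotv u v.
Proof. by rewrite dotvC dotvNr dotvC. Qed.

Lemma dotvBr u v w : dotv u (v - w) = dotv u v - dotv u w.
Proof. by rewrite dotvDr dotvNr. Qed.

Lemma dotvBl u v w : dotv (v - w) u = dotv v u - dotv w u.
Proof. by rewrite dotvDl dotvNl. Qed.

Lemma dotv0r u : dotv u 0 = 0.
Proof. by rewrite -(scale0r u) dotvZr mul0r. Qed.

Lemma dotv_sumr u (I : Type) (r : seq I) (P : pred I) (F : I -> 'cV[R]_d) :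
  dotv u (\sum_(i <- r | P i) F i) = \sum_(i <- r | P i) dotv u (F i).
Proof. by rewrite (big_morph _ (dotvDr u) (dotv0r u)). Qed.

Lemma l2norm_sq v : l2norm v ^+ 2 = dotv v v.
Proof.
rewrite dotvE /l2norm sqr_sqrtr; last by apply: sumr_ge0 => i _; exact: sqr_ge0.
by apply: eq_bigr => i _; rewrite expr2.
Qed.

Lemma l2norm_ge0 v : 0 <= l2norm v.
Proof. exact: sqrtr_ge0. Qed.

Lemma dotvv_ge0 v : 0 <= dotv v v.
Proof. by rewrite -l2norm_sq sqr_ge0. Qed.

Lemma dotvv_eq0 v : (dotv v v == 0) = (v == 0).
Proof.
apply/idP/eqP => [|->]; last by rewrite dotv0r.
rewrite dotvE psumr_eq0 => [/allP h|i _]; last by rewrite -expr2 sqr_ge0.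
apply/colP => i; have := h i (mem_index_enum _).
by rewrite mxE mulf_eq0 orbb => /eqP.
Qed.

Lemma dotvv_gt0 v : v != 0 -> 0 < dotv v v.
Proof. by move=> v0; rewrite lt_def dotvv_eq0 v0 dotvv_ge0. Qed.

Lemma l2norm_eq0 v : (l2norm v == 0) = (v == 0).
Proof. by rewrite -dotvv_eq0 -l2norm_sq sqrf_eq0. Qed.

Lemma l2norm_gt0 v : v != 0 -> 0 < l2norm v.
Proof. by move=> v0; rewrite lt_def l2norm_eq0 v0 l2norm_ge0. Qed.

Lemma l2normZ a v : l2norm (a *: v) = `|a| * l2norm v.
Proof.
apply/eqP; rewrite -(eqrXn2 (n := 2)) ?mulr_ge0 ?l2norm_ge0 //.
by rewrite exprMn !l2norm_sq dotvZl dotvZr mulrA -expr2 real_normK ?num_real.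
Qed.

Lemma l2normN v : l2norm (- v) = l2norm v.
Proof. by rewrite -scaleN1r l2normZ normrN1 mul1r. Qed.

Lemma l2norm0 : l2norm (0 : 'cV[R]_d) = 0.
Proof. by apply/eqP; rewrite l2norm_eq0. Qed.

(** Discriminant argument: evaluate at the minimizer [- b / c]. For [c = 0] the function is affine,
    and if [b] were nonzero the chosen point would give the value [- 1]. *)
Lemma sqr_le_of_quadratic_ge0 a b c : 0 <= c ->
  (forall t, 0 <= a + 2 * t * b + t ^+ 2 * c) -> b ^+ 2 <= a * c.
Proof.
move=> c_ge0 h; have [c0|c_neq0] := eqVneq c 0.
  have [->|b0] := eqVneq b 0; first by rewrite c0 expr0n mulr0.
  have := h (- (a + 1) / (2 * b)).
  suff -> : a + 2 * (- (a + 1) / (2 * b)) * b + (- (a + 1) / (2 * b)) ^+ 2 * c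
      = - 1 by rewrite oppr_ge0 ler10.
  by rewrite c0; field; rewrite b0.
have c_gt0 : 0 < c by rewrite lt_def c_neq0.
have := h (- b / c).
have -> : a + 2 * (- b / c) * b + (- b / c) ^+ 2 * c = a - b ^+ 2 / c by field.
by rewrite subr_ge0 ler_pdivrMr.
Qed.

Lemma dotv_mulmxl A u v : dotv (A *m u) v = dotv u (A^T *m v).
Proof. by rewrite /dotv trmx_mul mulmxA. Qed.

Lemma dotv_symmx A u v : A^T = A -> dotv (A *m u) v = dotv u (A *m v).
Proof. by move=> As; rewrite dotv_mulmxl As. Qed.

(** The form is nonnegative at [u + t v] for every [t]. Semidefiniteness is enough, so the
    inequality also applies to [A - c] at the least eigenvalue [c], where definiteness fails. *)
Lemma psd_cauchy_schwarz A u v : A^T = A ->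
  (forall w, 0 <= dotv w (A *m w)) ->
  dotv u (A *m v) ^+ 2 <= dotv u (A *m u) * dotv v (A *m v).
Proof.
move=> As A_ge0; apply: sqr_le_of_quadratic_ge0 => // t.
have := A_ge0 (u + t *: v).
rewrite mulmxDr -scalemxAr !dotvDl !dotvDr !dotvZl !dotvZr.
rewrite -[dotv v (A *m u)]dotvC dotv_symmx // => /le_trans; apply.
by rewrite le_eqVlt; apply/orP; left; apply/eqP; ring.
Qed.

Lemma ler_dotv u v : dotv u v <= l2norm u * l2norm v.
Proof.
have := @psd_cauchy_schwarz 1%:M u v (trmx1 _ _).
rewrite !mul1mx -!l2norm_sq -exprMn => h.
apply: le_trans (ler_norm _) _.
rewrite -ler_sqr ?nnegrE ?mulr_ge0 ?l2norm_ge0 //.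
rewrite real_normK ?num_real //; apply: h => w.
by rewrite mul1mx dotvv_ge0.
Qed.

Lemma ler_norm_dotv u v : `|dotv u v| <= l2norm u * l2norm v.
Proof.
rewrite ler_norml ler_dotv andbT lerNl -dotvNl.
by rewrite -[l2norm u]l2normN ler_dotv.
Qed.

Lemma ler_l2normD u v : l2norm (u + v) <= l2norm u + l2norm v.
Proof.
rewrite -ler_sqr ?nnegrE ?addr_ge0 ?l2norm_ge0 //.
rewrite sqrrD !l2norm_sq dotvDl !dotvDr [dotv v u]dotvC.
have := ler_dotv u v; lra.
Qed.

Lemma ler_l2normB u v : l2norm (u - v) <= l2norm u + l2norm v.
Proof. by rewrite -[l2norm v]l2normN ler_l2normD. Qed.

Lemma ler_l2norm_sum (I : Type) (r : seq I) (P : pred I) (F : I -> 'cV[R]_d) :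
  l2norm (\sum_(i <- r | P i) F i) <= \sum_(i <- r | P i) l2norm (F i).
Proof.
elim/big_rec2: _ => [|i x y _ h]; first by rewrite l2norm0.
exact: le_trans (ler_l2normD _ _) (lerD _ _).
Qed.

Lemma l2norm_mulmx_ge (A : 'M[R]_d) c v :
  c * dotv v v <= dotv v (A *m v) -> c * l2norm v <= l2norm (A *m v).
Proof.
have [->|v0] := eqVneq v 0; first by rewrite l2norm0 mulr0 l2norm_ge0.
rewrite -l2norm_sq => h; rewrite -(ler_pM2l (l2norm_gt0 v0)).
by apply: le_trans (ler_dotv _ _); rewrite mulrCA -expr2.
Qed.

(** Cauchy-Schwarz for the form of [A] at [A v] and [v] gives [|A v|^4 <= c |A v|^2 * c |v|^2];
    divide by [|A v|^2]. *)
Lemma l2norm_mulmx_le (A : 'M[R]_d) c v : A^T = A ->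
  (forall w, 0 <= dotv w (A *m w)) ->
  (forall w, dotv w (A *m w) <= c * dotv w w) ->
  l2norm (A *m v) <= c * l2norm v.
Proof.
move=> As A_ge0 Ac; have [->|Av0] := eqVneq (A *m v) 0.
  rewrite l2norm0; have [->|v0] := eqVneq v 0; first by rewrite l2norm0 mulr0.
  rewrite mulr_ge0 ?l2norm_ge0 //.
  by have := le_trans (A_ge0 v) (Ac v); rewrite pmulr_lge0 // dotvv_gt0.
have v0 : v != 0 by apply: contraNneq Av0 => ->; rewrite mulmx0.
have := psd_cauchy_schwarz (A *m v) v As A_ge0.
set w := A *m v; rewrite -l2norm_sq => h.
have c_ge0 : 0 <= c.
  by have := le_trans (A_ge0 v) (Ac v); rewrite pmulr_lge0 // dotvv_gt0.
have {}h : (l2norm w ^+ 2) ^+ 2 <= c * l2norm w ^+ 2 * (c * l2norm v ^+ 2).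
  by apply: le_trans h _; rewrite !l2norm_sq ler_pM.
rewrite -ler_sqr ?nnegrE ?mulr_ge0 ?l2norm_ge0 //.
have w2 : 0 < l2norm w ^+ 2 by rewrite exprn_gt0 // l2norm_gt0.
by rewrite -(ler_pM2l w2) -expr2; apply: le_trans h _; rewrite exprMn; lra.
Qed.

End DotProduct.

(** * Square roots of positive definite matrices *)

Section SymmetricMatrices.
Variable (R : realType).

(** Row vectors are used because the minimum on the sphere is taken with [EVT_min_rV]; transposition
    returns to columns. *)
Lemma quadratic_form_continuous (d : nat) (A : 'M[R]_d) :
  continuous (fun x : 'rV[R]_d => dotv x^T (A *m x^T)).
Proof.
move=> x.
have sumC (F : 'I_d -> 'rV[R]_d -> R) : (forall i, continuous (F i)) ->
    continuous (fun y => \sum_(i < d) F i y).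
  move=> Fc y; rewrite (_ : (fun y => _) = \sum_(i < d) F i); last first.
    by apply/funext => z; rewrite fct_sumE.
  elim/big_ind: _ => [|g h cg ch|i _]; [exact: cst_continuous| |exact: Fc].
  exact: continuousD.
rewrite (_ : (fun x : 'rV[R]_d => _) = (fun x : 'rV[R]_d =>
   \sum_(i < d) (x 0 i * \sum_(j < d) (A i j * x 0 j)))); last first.
  apply/funext => y; rewrite dotvE; apply: eq_bigr => i _; rewrite !mxE.
  by congr (_ * _); apply: eq_bigr => j _; rewrite mxE.
apply: (sumC (fun i (y : 'rV[R]_d) => y 0 i * \sum_(j < d) (A i j * y 0 j))).
move=> i y; apply: continuousM; first exact: coord_continuous.
apply: (sumC (fun j (y : 'rV[R]_d) => A i j * y 0 j)) => j z.
by apply: continuousM; [exact: cst_continuous|exact: coord_continuous].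
Qed.

Lemma unit_sphere_compact (d : nat) :
  compact [set x : 'rV[R]_d | dotv x^T x^T = 1].
Proof.
apply: bounded_closed_compact.
  exists 1; split; first exact: num_real.
  move=> M M1 x /= x1; rewrite /Num.norm /= mx_normrE.
  apply/bigmax_leP; split=> [|[i j] _ /=].
    by rewrite ltW // (lt_trans _ M1).
  apply: le_trans (ltW M1); rewrite -(@expr_le1 _ 2) // real_normK ?num_real //.
  rewrite -x1 dotvE (bigD1 j) //= !mxE (ord1 i) -expr2 lerDl.
  by apply: sumr_ge0 => k _; rewrite -expr2 sqr_ge0.
rewrite (_ : [set x | _] =
    (fun x : 'rV[R]_d => dotv x^T (1%:M *m x^T)) @^-1` [set 1]).
  apply: closed_comp => [x _|]; first exact: quadratic_form_continuous.
  exact: closed_eq.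
by apply/seteqP; split => x /=; rewrite mul1mx.
Qed.

(* A minimizer [v] of the quadratic form on the unit sphere is isotropic for
   the positive semidefinite form [A - c], so [(A - c) v = 0] by
   Cauchy-Schwarz. *)
Lemma symmx_min_eigenvector (d : nat) (A : 'M[R]_d.+1) : A^T = A ->
  exists (c : R) (v : 'cV[R]_d.+1), [/\ dotv v v = 1, A *m v = c *: v &
    forall w, c * dotv w w <= dotv w (A *m w)].
Proof.
move=> As; pose q (x : 'rV[R]_d.+1) := dotv x^T (A *m x^T).
have S0 : [set x : 'rV[R]_d.+1 | dotv x^T x^T = 1] !=set0.
  exists (delta_mx 0 0); rewrite /= dotvE (bigD1 0) //= big1 => [|i i0].
    by rewrite !mxE eqxx mul1r addr0.
  by rewrite !mxE (negbTE i0) mul0r.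
have [] := @EVT_min_rV R _ q _ S0 (@unit_sphere_compact _).
  exact/continuous_subspaceT/quadratic_form_continuous.
move=> x; rewrite inE /= => x1 qmin.
pose c := q x; pose v := x^T; exists c, v.
have cmin w : c * dotv w w <= dotv w (A *m w).
  have [->|w0] := eqVneq w 0; first by rewrite mulmx0 !dotv0r mulr0.
  have lw : 0 < l2norm w by rewrite l2norm_gt0.
  have w1 : dotv ((l2norm w)^-1 *: w) ((l2norm w)^-1 *: w) = 1.
    by rewrite dotvZl dotvZr -l2norm_sq; field; rewrite gt_eqF.
  have := qmin ((l2norm w)^-1 *: w)^T.
  rewrite inE /= /q !trmxK => /(_ w1).
  rewrite -/(q x) -/c -scalemxAr !dotvZl !dotvZr mulrA -expr2 exprVn.
  by rewrite -l2norm_sq ler_pdivlMl ?exprn_gt0 // mulrC.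
split=> //; pose N := A - c%:M.
have NE w : N *m w = A *m w - c *: w by rewrite mulmxBl mul_scalar_mx.
have Ns : N^T = N by rewrite /N raddfB /= As tr_scalar_mx.
have N_ge0 w : 0 <= dotv w (N *m w) by rewrite NE dotvBr dotvZr subr_ge0.
have := psd_cauchy_schwarz (N *m v) v Ns N_ge0.
have -> : dotv v (N *m v) = 0 by rewrite NE dotvBr dotvZr x1 mulr1 subrr.
rewrite mulr0 => h; have : dotv (N *m v) (N *m v) == 0.
  by rewrite -sqrf_eq0 eq_le h sqr_ge0.
by rewrite dotvv_eq0 NE subr_eq0 => /eqP.
Qed.

Lemma posdefmxP (d : nat) (A : 'M[R]_d) :
  posdefmx A <-> A^T = A /\ forall v, v != 0 -> 0 < dotv v (A *m v).
Proof.
by split=> -[As h]; split=> // v v0; have := h v v0; rewrite /dotv mulmxA.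
Qed.

Lemma posdefmx_ge0 (d : nat) (A : 'M[R]_d) v :
  posdefmx A -> 0 <= dotv v (A *m v).
Proof.
case/posdefmxP=> _ h; have [->|v0] := eqVneq v 0; last exact/ltW/h.
by rewrite mulmx0 dotv0r.
Qed.

Lemma posdefmx_unit (d : nat) (A : 'M[R]_d) : posdefmx A -> A \in unitmx.
Proof.
case/posdefmxP => As h; rewrite -row_free_unit -kermx_eq0.
apply/eqP/row_matrixP => i; rewrite row0; apply/eqP/negPn/negP => ri.
have /h : (row i (kermx A))^T != 0 by rewrite -trmx0 (inj_eq trmx_inj).
by rewrite -{2}As -trmx_mul -row_mul mulmx_ker row0 trmx0 dotv0r ltxx.
Qed.

Lemma posdefmx_inv (d : nat) (A : 'M[R]_d) : posdefmx A -> posdefmx (invmx A).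
Proof.
move=> Ap; have Au := posdefmx_unit Ap.
case/posdefmxP: (Ap) => As h; apply/posdefmxP.
split; first by rewrite trmx_inv As.
move=> v v0; have := h (invmx A *m v); rewrite mulKVmx // dotvC; apply.
by apply: contraNneq v0 => /(congr1 (mulmx A)); rewrite mulKVmx // mulmx0 => ->.
Qed.

Lemma posdefmx_conj (d : nat) (A Q : 'M[R]_d) :
  Q^T = Q -> Q *m Q = 1%:M -> posdefmx A -> posdefmx (Q *m A *m Q).
Proof.
move=> Qs QQ /posdefmxP[As h]; apply/posdefmxP; split.
  by rewrite !trmx_mul Qs As mulmxA.
move=> v v0; rewrite -!mulmxA -dotv_symmx //; apply: h.
apply: contraNneq v0 => /(congr1 (mulmx Q)).
by rewrite mulmxA QQ mul1mx mulmx0 => ->.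
Qed.

(** The reflection along [w = v - e] exchanges the unit vectors [v] and [e]. It degenerates for
    [v = e], where the identity serves. *)
Lemma householder (d : nat) (v : 'cV[R]_d.+1) : dotv v v = 1 ->
  exists Q : 'M[R]_d.+1,
    [/\ Q^T = Q, Q *m Q = 1%:M & Q *m delta_mx 0 0 = v].
Proof.
move=> v1; set e : 'cV[R]_d.+1 := delta_mx 0 0.
have e1 : dotv e e = 1.
  rewrite dotvE (bigD1 0) //= big1 => [|i i0].
    by rewrite !mxE eqxx mul1r addr0.
  by rewrite !mxE (negbTE i0) mul0r.
have [->|ve] := eqVneq v e.
  by exists 1%:M; rewrite trmx1 !mul1mx.
pose w := v - e; pose s := dotv w w.
have s0 : s != 0 by rewrite /s dotvv_eq0 subr_eq0.
have wMw (u : 'cV[R]_d.+1) : w *m w^T *m u = dotv w u *: w.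
  by rewrite -mulmxA [w^T *m u]mx11_scalar mul_mx_scalar.
have we : dotv w e = - s / 2.
  by rewrite /s /w !dotvBl !dotvBr v1 e1 [dotv e v]dotvC; field.
pose Q := 1%:M - (2 / s) *: (w *m w^T).
exists Q; rewrite /Q; split.
- by rewrite raddfB /= trmx1 linearZ /= trmx_mul trmxK.
- have WW : w *m w^T *m (w *m w^T) = s *: (w *m w^T).
    by rewrite mulmxA wMw -scalemxAl.
  rewrite mulmxBl !mulmxBr !mul1mx mulmx1 -scalemxAl -scalemxAr WW !scalerA.
  rewrite (_ : 2 / s * (2 / s) * s = 2 / s + 2 / s); last by field.
  by rewrite scalerDl opprB addrK subrK.
- rewrite mulmxBl mul1mx -scalemxAl wMw scalerA we.
  rewrite (_ : 2 / s * (- s / 2) = -1); last by field.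
  by rewrite scaleN1r opprK /w addrC subrK.
Qed.

Lemma dotv_col_mx (p q : nat) (u1 v1 : 'cV[R]_p) (u2 v2 : 'cV[R]_q) :
  dotv (col_mx u1 u2) (col_mx v1 v2) = dotv u1 v1 + dotv u2 v2.
Proof. by rewrite /dotv tr_col_mx mul_row_col mxE. Qed.

(** Deflation, by induction on the dimension: a reflection [Q] moves an eigenvector to the first
    coordinate, so that [Q A Q] is block diagonal with an eigenvalue [c > 0] and a smaller positive
    definite block. Take roots of both blocks and conjugate back. *)
Lemma posdefmx_sqrt (d : nat) (A : 'M[R]_d) :
  posdefmx A -> exists S, posdefmx S /\ S *m S = A.
Proof.
elim: d A => [|d IH] A Ap.
  by exists A; rewrite [A *m A]flatmx0 [RHS]flatmx0.
have [c [v [v1 Av _]]] := symmx_min_eigenvector (proj1 Ap).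
have c0 : 0 < c.
  have /posdefmxP[_ /(_ v)] := Ap; rewrite Av dotvZr v1 mulr1; apply.
  by rewrite -dotvv_eq0 v1 oner_neq0.
have [Q [Qs QQ Qe]] := householder v1.
pose A' : 'M[R]_(1 + d) := Q *m A *m Q.
have Ap' : posdefmx A' := posdefmx_conj Qs QQ Ap.
have Ae : (Q *m A *m Q) *m delta_mx 0 0 = c *: (delta_mx 0 0 : 'cV_d.+1).
  by rewrite -!mulmxA Qe Av -scalemxAr -Qe mulmxA QQ mul1mx.
have [A's A'_gt0] := iffLR (posdefmxP _) Ap'.
have A'l i : A' i 0 = c * (i == 0)%:R.
  have /matrixP/(_ i 0) := Ae; rewrite [RHS]mxE [in RHS]mxE andbT => <-.
  rewrite [RHS]mxE (bigD1 0) //= big1 => [|k k0]; last first.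
    by rewrite [X in _ * X]mxE (negbTE k0) mulr0.
  by rewrite [X in _ * X]mxE eqxx mulr1 addr0.
have QA'Q : Q *m A' *m Q = A.
  by rewrite /A' -!mulmxA QQ mulmx1 mulmxA QQ mul1mx.
clearbody A'.
have A'c0 : A' (lshift d 0) (lshift d 0) = c.
  have := A'l 0; rewrite eqxx mulr1 => <-.
  by congr (A' _ _); exact: val_inj.
have A'ul : ulsubmx A' = c%:M.
  by apply/matrixP => i j; rewrite (ord1 i) (ord1 j) !mxE A'c0.
have A'dl : dlsubmx A' = 0.
  apply/matrixP => i j; rewrite (ord1 j) !mxE.
  have := A'l (lift 0 i); rewrite mulr0 => <-.
  by congr (A' _ _); exact: val_inj.
have A'ur : ursubmx A' = 0 by rewrite -[LHS]trmxK trmx_ursub A's A'dl trmx0.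
have A'E : A' = block_mx c%:M 0 0 (drsubmx A').
  by rewrite -[LHS]submxK A'ul A'ur A'dl.
have Bp : posdefmx (drsubmx A').
  apply/posdefmxP; split=> [|w w0]; first by rewrite trmx_drsub A's.
  have := A'_gt0 (col_mx 0 w); rewrite A'E mul_block_col !mulmx0 !mul0mx !add0r.
  rewrite -A'E dotv_col_mx dotv0r add0r; apply.
  by apply: contraNneq w0 => h; rewrite -[w](col_mxKd (0 : 'cV[R]_1)) h linear0.
have [S2 [S2p S2S2]] := IH _ Bp.
pose S' : 'M[R]_(1 + d) := block_mx (Num.sqrt c)%:M 0 0 S2.
have S'p : posdefmx S'.
  apply/posdefmxP; split.
    by rewrite /S' tr_block_mx !trmx0 tr_scalar_mx (proj1 S2p).
  move=> w; rewrite -[w]vsubmxK => w0.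
  rewrite /S' mul_block_col !mul0mx addr0 add0r dotv_col_mx.
  rewrite mul_scalar_mx dotvZr.
  have sc : 0 < Num.sqrt c by rewrite sqrtr_gt0.
  have [u0|u0] := eqVneq (usubmx w) 0; last first.
    by apply: ltr_pwDl; rewrite ?mulr_gt0 ?dotvv_gt0 ?posdefmx_ge0.
  apply: ltr_wpDl; first by rewrite mulr_ge0 ?dotvv_ge0 // ltW.
  have /posdefmxP[_] := S2p; apply.
  by apply: contraNneq w0 => d0; rewrite u0 d0 col_mx0.
exists (Q *m S' *m Q); split; last first.
  have -> : Q *m S' *m Q *m (Q *m S' *m Q) = Q *m (S' *m S') *m Q.
    by rewrite -!mulmxA (mulmxA Q Q) QQ mul1mx.
  rewrite mulmx_block !mulmx0 !mul0mx !addr0 !add0r S2S2 -scalar_mxM -expr2.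
  by rewrite sqr_sqrtr ?ltW // -A'E.
exact: posdefmx_conj.
Qed.

Lemma invsqrtmxP (d : nat) (A : 'M[R]_d) : posdefmx A ->
  posdefmx (invsqrtmx A) /\ invsqrtmx A *m invsqrtmx A = invmx A.
Proof.
by move=> /posdefmx_inv/posdefmx_sqrt; exact: xgetPex.
Qed.

End SymmetricMatrices.

(** * Bounds on inverse square roots *)

Section InverseSquareRoot.
Variables (R : realType) (d : nat).
Implicit Types (A S P Q Y Z : 'M[R]_d) (u v w g : 'cV[R]_d) (c k K : R).

Lemma invsqrt_norm_sq A S v : S^T = S -> S *m S = invmx A ->
  l2norm (S *m v) ^+ 2 = dotv v (invmx A *m v).
Proof. by move=> Ss <-; rewrite l2norm_sq dotv_symmx // mulmxA. Qed.

(** For [u = A^{-1} v], the bound [k |u|^2 <= <u, v> <= |u| |v|] yields [k |u| <= |v|], while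
    [|S v|^2 = <v, u>]. *)
Lemma invsqrt_norm_le A S k v : posdefmx A -> S^T = S -> S *m S = invmx A ->
  0 < k -> (forall w, k * dotv w w <= dotv w (A *m w)) ->
  k * l2norm (S *m v) ^+ 2 <= l2norm v ^+ 2.
Proof.
move=> Ap Ss SA k0 kA; rewrite (invsqrt_norm_sq _ Ss SA).
set u := invmx A *m v; have := kA u; rewrite mulKVmx ?posdefmx_unit // => ku.
have uv := ler_dotv v u.
rewrite [dotv u v]dotvC -l2norm_sq in ku.
have [u0|u0] := eqVneq (l2norm u) 0.
  have := le_trans uv; rewrite u0 mulr0 => /(_ 0 (lexx _)) h.
  by apply: le_trans (sqr_ge0 _); rewrite pmulr_rle0.
have lu : 0 < l2norm u by rewrite lt_def u0 l2norm_ge0.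
have kuv : k * l2norm u <= l2norm v.
  by rewrite -(ler_pM2r lu) -mulrA -expr2 (le_trans ku).
apply: (le_trans (ler_wpM2l (ltW k0) uv)).
by rewrite mulrCA expr2 ler_wpM2l ?l2norm_ge0.
Qed.

(** Testing [A >= g g^T] at [A^{-1} g] reads [x^2 <= x] for [x = |S g|^2]. *)
Lemma invsqrt_norm_le1 A S g : posdefmx A -> S^T = S -> S *m S = invmx A ->
  (forall w, dotv g w ^+ 2 <= dotv w (A *m w)) -> l2norm (S *m g) <= 1.
Proof.
move=> Ap Ss SA gA; rewrite -(@expr_le1 _ 2) ?l2norm_ge0 //.
have := gA (invmx A *m g); rewrite mulKVmx ?posdefmx_unit //.
rewrite [X in _ <= X]dotvC -(invsqrt_norm_sq _ Ss SA).
set x := l2norm _ ^+ 2; have x_ge0 : 0 <= x by rewrite sqr_ge0.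
have [->|x0] := eqVneq x 0; first by rewrite ler01.
by rewrite -[X in _ <= X]mulr1 expr2 ler_pM2l // lt_def x0.
Qed.

(** With [w = S^{-1} v] one has [|w|^2 = <v, A v> <= K |v|^2]. Cauchy-Schwarz for the form of [S] at
    [v] and [w] then gives [|v|^4 <= <v, S v> <w, v>], where [<w, v> <= sqrt K |v|^2]. *)
Lemma invsqrt_form_ge A S K v : posdefmx A -> posdefmx S ->
  S *m S = invmx A -> 0 < K ->
  (forall w, dotv w (A *m w) <= K * dotv w w) ->
  (Num.sqrt K)^-1 * dotv v v <= dotv v (S *m v).
Proof.
move=> Ap Sp SA K0 AK; have [Ss _] := Sp.
have Su := posdefmx_unit Sp.
have sK : 0 < Num.sqrt K by rewrite sqrtr_gt0.
have [->|v0] := eqVneq v 0; first by rewrite mulmx0 !dotv0r mulr0.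
rewrite ler_pdivrMl //.
pose w := invmx S *m v.
have Sw : S *m w = v by rewrite mulKVmx.
have ww : dotv w w = dotv v (A *m v).
  rewrite /w dotv_symmx; last by rewrite trmx_inv Ss.
  rewrite mulmxA; congr (dotv v (_ *m v)).
  rewrite -[RHS](mulKmx Su) -[S *m A in RHS](mulKmx Su).
  by rewrite [S *m (S *m A)]mulmxA SA mulVmx ?posdefmx_unit // mulmx1.
have w_le : l2norm w <= Num.sqrt K * l2norm v.
  rewrite -ler_sqr ?nnegrE ?mulr_ge0 ?l2norm_ge0 ?(ltW sK) //.
  by rewrite exprMn (sqr_sqrtr (ltW K0)) !l2norm_sq ww.
have := psd_cauchy_schwarz v w Ss (fun z => posdefmx_ge0 z Sp); rewrite Sw.
have wv : dotv w v <= Num.sqrt K * dotv v v.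
  apply: le_trans (ler_dotv _ _) _; rewrite -[dotv v v]l2norm_sq expr2 mulrA.
  by rewrite ler_wpM2r ?l2norm_ge0.
move=> h; rewrite -(ler_pM2l (dotvv_gt0 v0)) -expr2 (le_trans h) //.
rewrite [leRHS](_ : _ = dotv v (S *m v) * (Num.sqrt K * dotv v v)); last first.
  by ring.
by rewrite ler_wpM2l ?posdefmx_ge0.
Qed.

Lemma mxtrace_tr_mul Y Z :
  \tr (Y^T *m Z) = \sum_i dotv (col i Y) (col i Z).
Proof.
rewrite /mxtrace; apply: eq_bigr => i _; rewrite dotvE mxE.
by apply: eq_bigr => j _; rewrite !mxE.
Qed.

Lemma mxtrace_form_ge P Y k : (forall w, k * dotv w w <= dotv w (P *m w)) ->
  k * \tr (Y^T *m Y) <= \tr (Y^T *m (P *m Y)).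
Proof.
move=> kP; rewrite !mxtrace_tr_mul mulr_sumr; apply: ler_sum => i _.
by rewrite !colE -mulmxA; exact: kP.
Qed.

Lemma l2norm_mulmx_frobenius Y g :
  l2norm (Y *m g) ^+ 2 <= \tr (Y^T *m Y) * l2norm g ^+ 2.
Proof.
have -> : \tr (Y^T *m Y) = \sum_i dotv (col i Y^T) (col i Y^T).
  by rewrite -mxtrace_tr_mul trmxK mxtrace_mulC.
rewrite mulr_suml l2norm_sq dotvE.
apply: ler_sum => i _.
have -> : (Y *m g) i 0 = dotv (col i Y^T) g.
  by rewrite dotvE mxE; apply: eq_bigr => j _; rewrite !mxE.
rewrite -l2norm_sq -expr2 -exprMn -real_normK ?num_real //.
by rewrite ler_sqr ?nnegrE ?mulr_ge0 ?l2norm_ge0 // ler_norm_dotv.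
Qed.

(* The Sylvester operator [Y |-> P Y + Y Q] is bounded below by [2 k] for the
   Frobenius inner product [tr (Y^T Z)]. *)
Lemma sylvester_bound P Q Y k z g : 0 < k ->
  (forall w, k * dotv w w <= dotv w (P *m w)) ->
  (forall w, k * dotv w w <= dotv w (Q *m w)) ->
  (forall w, l2norm ((P *m Y + Y *m Q) *m w) <= z * l2norm w) ->
  l2norm (Y *m g) ^+ 2 <= d%:R * (z / (2 * k)) ^+ 2 * l2norm g ^+ 2.
Proof.
move=> k0 kP kQ; set Z := P *m Y + Y *m Q => Zz.
apply: le_trans (l2norm_mulmx_frobenius _ _) _.
rewrite ler_wpM2r ?sqr_ge0 //.
have hP := mxtrace_form_ge Y kP.
have hQ : k * \tr (Y^T *m Y) <= \tr (Y^T *m (Y *m Q)).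
  have := mxtrace_form_ge Y^T kQ.
  by rewrite trmxK mxtrace_mulC mulmxA [X in _ <= X -> _]mxtrace_mulC.
have hZ : \tr (Y^T *m Z) = \tr (Y^T *m (P *m Y)) + \tr (Y^T *m (Y *m Q)).
  by rewrite mulmxDr raddfD.
(* Young's inequality [y z <= k y^2 + z^2 / (4 k)] in each column; the factor [d] counts the
   columns. *)
have hYZ : \tr (Y^T *m Z) <= k * \tr (Y^T *m Y) + d%:R * (z ^+ 2 / (4 * k)).
  rewrite !mxtrace_tr_mul mulr_sumr -[X in X%:R]card_ord -sum1_card natr_sum.
  rewrite mulr_suml -big_split /=; apply: ler_sum => i _; rewrite mul1r.
  have Zi : l2norm (col i Z) <= z.
    have := Zz (delta_mx i 0); rewrite -colE => /le_trans; apply.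
    suff -> : l2norm (delta_mx i 0 : 'cV[R]_d) = 1 by rewrite mulr1.
    apply/eqP; rewrite -(eqrXn2 (n := 2)) ?l2norm_ge0 ?ler01 //.
    rewrite l2norm_sq expr1n dotvE (bigD1 i) //= big1 => [|j ji].
      by rewrite !mxE !eqxx mulr1 addr0.
    by rewrite !mxE (negbTE ji) mul0r.
  have := ler_dotv (col i Y) (col i Z); rewrite -l2norm_sq.
  have := l2norm_ge0 (col i Y); have := l2norm_ge0 (col i Z).
  move: (l2norm (col i Y)) (l2norm (col i Z)) Zi => y t tz t0 y0 h.
  apply: le_trans h _; apply: le_trans (ler_wpM2l y0 tz) _.
  have -> : k * y ^+ 2 + z ^+ 2 / (4 * k) = y * z + k * (y - z / (2 * k)) ^+ 2.
    by field; rewrite gt_eqF.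
  by rewrite lerDl mulr_ge0 ?sqr_ge0 // ltW.
have {}hYZ : k * \tr (Y^T *m Y) <= d%:R * (z ^+ 2 / (4 * k)) by lra.
rewrite -(ler_pM2l k0); apply: le_trans hYZ _.
by rewrite le_eqVlt; apply/orP; left; apply/eqP; field; rewrite gt_eqF.
Qed.

(** The difference [Y = SA - SB] solves [SA Y + Y SB = A^{-1} - B^{-1} = A^{-1} (B - A) B^{-1}]. The
    right side has operator norm at most [c / k^2], and the forms of [SA] and [SB] are at least
    [1 / sqrt K], so [sylvester_bound] applies. *)
Lemma invsqrt_perturbation A B SA SB c k K g :
  posdefmx A -> posdefmx B -> posdefmx SA -> posdefmx SB ->
  SA *m SA = invmx A -> SB *m SB = invmx B -> 0 < k -> 0 < K ->
  (forall w, k * dotv w w <= dotv w (A *m w)) ->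
  (forall w, dotv w (B *m w) <= K * dotv w w) ->
  (forall w, 0 <= dotv w ((B - A) *m w)) ->
  (forall w, dotv w ((B - A) *m w) <= c * dotv w w) ->
  l2norm ((SA - SB) *m g) ^+ 2 <=
    d%:R * (c / k ^+ 2 * Num.sqrt K / 2) ^+ 2 * l2norm g ^+ 2.
Proof.
move=> Ap Bp SAp SBp SSA SSB k0 K0 kA BK E0 Ec.
have [SAs _] := SAp; have [SBs _] := SBp.
have [As _] := Ap; have [Bs _] := Bp.
have AB w : dotv w (A *m w) <= dotv w (B *m w).
  by rewrite -subr_ge0 -dotvBr -mulmxBl.
have kB w : k * dotv w w <= dotv w (B *m w) := le_trans (kA w) (AB w).
have AK w : dotv w (A *m w) <= K * dotv w w := le_trans (AB w) (BK w).
have sK : 0 < Num.sqrt K by rewrite sqrtr_gt0.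
have sylE : SA *m (SA - SB) + (SA - SB) *m SB =
    SA *m SA *m (B - A) *m (SB *m SB).
  rewrite mulmxBr mulmxBl addrA subrK SSA SSB.
  rewrite mulmxBr mulmxBl mulVmx ?posdefmx_unit // mul1mx -mulmxA.
  by rewrite mulmxV ?posdefmx_unit // mulmx1.
have -> : c / k ^+ 2 * Num.sqrt K / 2 = c / k ^+ 2 / (2 * (Num.sqrt K)^-1).
  by field; rewrite !gt_eqF.
apply: (@sylvester_bound SA SB) => [|w|w|w].
- by rewrite invr_gt0.
- exact: invsqrt_form_ge SSA K0 AK.
- exact: invsqrt_form_ge SSB K0 BK.
have SSle (C SC : 'M[R]_d) v : posdefmx C -> posdefmx SC ->
    SC *m SC = invmx C -> (forall w, k * dotv w w <= dotv w (C *m w)) ->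
    k * l2norm (SC *m SC *m v) <= l2norm v.
  move=> Cp [SCs _] SSC kC.
  rewrite -ler_sqr ?nnegrE ?mulr_ge0 ?l2norm_ge0 ?(ltW k0) //.
  rewrite exprMn expr2 -mulrA -mulmxA.
  have h1 := invsqrt_norm_le (SC *m v) Cp SCs SSC k0 kC.
  have h2 := invsqrt_norm_le v Cp SCs SSC k0 kC.
  exact: le_trans (ler_wpM2l (ltW k0) h1) h2.
rewrite sylE -2!mulmxA; set u := _ *m w.
have hu : k * l2norm u <= l2norm w := SSle B SB w Bp SBp SSB kB.
have hE : l2norm ((B - A) *m u) <= c * l2norm u.
  by apply: l2norm_mulmx_le => //; rewrite raddfB /= Bs As.
have hA := SSle A SA ((B - A) *m u) Ap SAp SSA kA.
rewrite -(ler_pM2l (exprn_gt0 2 k0)).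
rewrite (_ : k ^+ 2 * (c / k ^+ 2 * _) = c * l2norm w); last first.
  by field; rewrite gt_eqF.
rewrite expr2 -mulrA; apply: le_trans (ler_wpM2l (ltW k0) (le_trans hA hE)) _.
rewrite mulrCA; have [w0|w0] := eqVneq w 0.
  by rewrite /u w0 mulmx0 l2norm0 !mulr0.
have c0 : 0 <= c.
  by have := le_trans (E0 w) (Ec w); rewrite pmulr_lge0 // dotvv_gt0.
exact: ler_wpM2l.
Qed.

End InverseSquareRoot.

(** * Condition number of the Gram matrix *)

Section GramMatrix.
Variable (R : realType).

(** The least and largest eigenvalues [c] and [C] are singular values and enclose all others, so the
    hypothesis says [C <= ckappa c]. The product form of the conclusion avoids dividing by [v] or
    [w]. *)
Lemma posdefmx_condition_number (m : nat) (M : 'M[R]_m) (ckappa : R)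
    (v w : 'cV[R]_m) : posdefmx M ->
  max_singular_value M / min_singular_value M <= ckappa ->
  dotv v (M *m v) * dotv w w <= ckappa * (dotv w (M *m w) * dotv v v).
Proof.
case: m M v w => [|m] M v w Mp Mk.
  by rewrite [v]flatmx0 [w]flatmx0 !dotv0r !mulr0.
have [Ms M_gt0] := iffLR (posdefmxP _) Mp.
have [c [x [x1 Mx cM]]] := symmx_min_eigenvector Ms.
(* The largest eigenvalue is minus the least eigenvalue of [- M]. *)
have [C [y [y1 My CM]]] : exists C y, [/\ dotv y y = 1, M *m y = C *: y &
    forall w, dotv w (M *m w) <= C * dotv w w].
  have [|C [y [y1 My CM]]] := @symmx_min_eigenvector R m (- M).
    by rewrite raddfN /= Ms.
  exists (- C), y; split=> // [|z].
    by rewrite -[M]opprK mulNmx My scaleNr.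
  by rewrite -[M]opprK mulNmx dotvNr mulNr lerN2 CM.
have eigen_gt0 b (z : 'cV[R]_m.+1) : dotv z z = 1 -> M *m z = b *: z -> 0 < b.
  move=> z1 Mz; have := M_gt0 z; rewrite Mz dotvZr z1 mulr1; apply.
  by rewrite -dotvv_eq0 z1 oner_neq0.
have c0 := eigen_gt0 _ _ x1 Mx; have C0 := eigen_gt0 _ _ y1 My.
have SVin b (z : 'cV[R]_m.+1) : dotv z z = 1 -> M *m z = b *: z ->
    singular_values M b.
  move=> z1 Mz; split; first exact/ltW/(eigen_gt0 _ z).
  apply/eigenvalueP; exists z^T; last first.
    by rewrite -trmx0 (inj_eq trmx_inj) -dotvv_eq0 z1 oner_neq0.
  apply: trmx_inj; rewrite trmx_mul trmxK trmx_mul trmxK Ms.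
  by rewrite -mulmxA Mz -scalemxAr Mz scalerA -expr2 linearZ /= trmxK.
have SVbound s : singular_values M s -> c <= s <= C.
  case=> s0 /eigenvalueP[z zM z0].
  have MMz : M *m (M *m z^T) = s ^+ 2 *: z^T.
    apply: trmx_inj.
    by rewrite !trmx_mul trmxK -mulmxA {2}Ms zM linearZ /= trmxK.
  have lz : 0 < l2norm z^T by rewrite l2norm_gt0 // -trmx0 (inj_eq trmx_inj).
  have Mz : l2norm (M *m z^T) = s * l2norm z^T.
    apply/eqP; rewrite -(eqrXn2 (n := 2)) ?mulr_ge0 ?l2norm_ge0 //.
    by rewrite exprMn !l2norm_sq dotv_symmx // MMz dotvZr.
  apply/andP; split; rewrite -(ler_pM2r lz) -Mz; first exact: l2norm_mulmx_ge.
  by apply: l2norm_mulmx_le => // z'; exact: posdefmx_ge0.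
have sup_ge : C <= max_singular_value M.
  apply: ub_le_sup; last exact: SVin My.
  by exists C => s /SVbound/andP[].
have inf_le : min_singular_value M <= c.
  apply: ge_inf; last exact: SVin Mx.
  by exists c => s /SVbound/andP[].
(* This makes the infimum positive, so that its inverse can be compared with [c^-1]. *)
have inf_ge : c <= min_singular_value M.
  apply: lb_le_inf; first by exists c; exact: SVin Mx.
  by move=> s /SVbound/andP[].
have Cc : C <= ckappa * c.
  rewrite -ler_pdivrMr // (le_trans _ Mk) //.
  rewrite ler_pM ?(ltW C0) ?invr_ge0 ?(ltW c0) // lef_pV2 ?posrE //.
  exact: lt_le_trans inf_ge.
have k0 : 0 <= ckappa.
  by rewrite -(pmulr_lge0 _ c0) (le_trans (ltW C0)).
apply: (le_trans (ler_wpM2r (dotvv_ge0 w) (CM v))).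
apply: (@le_trans _ _ (ckappa * c * (dotv w w * dotv v v))).
  rewrite (_ : _ * dotv w w = C * (dotv w w * dotv v v)); last by ring.
  by rewrite ler_wpM2r // mulr_ge0 ?dotvv_ge0.
by rewrite -mulrA ler_wpM2l // mulrA ler_wpM2r ?dotvv_ge0.
Qed.

Lemma gram_posdefmx (d m : nat) (H : 'M[R]_(d, m)) :
  \rank H = m -> posdefmx (H^T *m H).
Proof.
move=> rH; apply/posdefmxP; split; first by rewrite trmx_mul trmxK.
move=> v v0; rewrite -mulmxA.
have -> : dotv v (H^T *m (H *m v)) = dotv (H *m v) (H *m v).
  by rewrite /dotv trmx_mul mulmxA.
apply: dotvv_gt0; apply: contraNneq v0 => Hv.
have fH : row_free H^T by rewrite /row_free mxrank_tr rH.
apply/eqP/trmx_inj/(row_free_inj fH).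
by rewrite trmx0 mul0mx -trmx_mul Hv trmx0.
Qed.

(* Averaging the form of [H^T H] over the coordinate vectors gives its trace;
   the condition number then controls its value at [(1, ..., 1)]. *)
Lemma sum_col_norm_ge (d m : nat) (H : 'M[R]_(d, m)) (ckappa : R) :
  \rank H = m ->
  max_singular_value (H^T *m H) / min_singular_value (H^T *m H) <= ckappa ->
  \sum_j l2norm (col j H) ^+ 2 <= ckappa * l2norm (\sum_j col j H) ^+ 2.
Proof.
move=> rH Hk; have [m0|m0] := posnP m.
  move: H rH Hk; rewrite m0 => H _ _; rewrite !big_ord0 l2norm0.
  by rewrite expr0n mulr0.
have Hp := gram_posdefmx rH.
pose u : 'cV[R]_m := const_mx 1.
have uu : dotv u u = m%:R.
  rewrite dotvE (eq_bigr (fun=> 1)) => [|i _]; last by rewrite !mxE mulr1.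
  by rewrite sumr_const card_ord.
have formE (v : 'cV[R]_m) : dotv v (H^T *m H *m v) = l2norm (H *m v) ^+ 2.
  by rewrite l2norm_sq /dotv trmx_mul !mulmxA.
have Hu : H *m u = \sum_j col j H.
  apply/colP => i; rewrite mxE summxE; apply: eq_bigr => j _.
  by rewrite !mxE mulr1.
have mR : 0 < m%:R :> R by rewrite ltr0n.
rewrite -(ler_pM2r mR) mulr_suml -Hu -formE.
rewrite [leRHS]mulrC -[X in X%:R * _]card_ord mulr_natl -sumr_const.
apply: ler_sum => j _.
have := posdefmx_condition_number (delta_mx j 0) u Hp Hk.
rewrite uu formE -colE => /le_trans; apply.
suff -> : dotv (delta_mx j 0 : 'cV[R]_m) (delta_mx j 0) = 1 by rewrite mulr1.
rewrite dotvE (bigD1 j) //= big1 => [|i ij].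
  by rewrite !mxE !eqxx mulr1 addr0.
by rewrite !mxE (negbTE ij) mul0r.
Qed.

End GramMatrix.

(** * Calculus *)

Section Calculus.
Variables (R : realType) (d : nat).
Implicit Types (f : 'cV[R]_d -> R) (x y v : 'cV[R]_d).

Lemma derive_grad f x v : differentiable f x -> 'D_v f x = dotv (grad f x) v.
Proof.
move=> fx; rewrite deriveE // dotvE.
have {1}-> : v = \sum_i v i 0 *: delta_mx i 0.
  rewrite [LHS]matrix_sum_delta; apply: eq_bigr => i _.
  by rewrite big_ord1.
rewrite linear_sum; apply: eq_bigr => i _.
by rewrite linearZ /= mxE deriveE // mulrC.
Qed.

Lemma grad_mvt f x y : (forall z, differentiable f z) ->
  exists2 t, 0 <= t <= 1 &
    f y - f x = dotv (grad f (x + t *: (y - x))) (y - x).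
Proof.
move=> df; pose v := y - x; pose h (t : R) := f (x + t *: v).
(* The difference quotient of [h] at [t] is the one of [f] at [x + t v] in direction [v]. *)
have quot (t : R) : (fun e : R => e^-1 *: ((h \o shift t) (e *: 1) - h t)) =
    (fun e : R =>
      e^-1 *: ((f \o shift (x + t *: v)) (e *: v) - f (x + t *: v))).
  apply/funext => e; rewrite /h /= (_ : e *: (1 : R) = e); last exact: mulr1.
  by rewrite scalerDl addrCA.
have dh (t : R) : is_derive t 1 h (dotv (grad f (x + t *: v)) v).
  split; last by rewrite -derive_grad // /derive quot.
  by rewrite /derivable quot; exact: diff_derivable.
have hc : {within `[0, 1], continuous h}.
  apply: continuous_subspaceT => t.
  by apply/differentiable_continuous/derivable1_diffP; case: (dh t).
have [] := MVT ltr01 (fun t _ => dh t) hc.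
move=> t; rewrite in_itv /= => /andP[t0 t1] ht; exists t; first by rewrite !ltW.
move: ht; rewrite /h scale1r scale0r addr0 subr0 mulr1 /v.
by rewrite [x + (y - x)]addrC subrK.
Qed.

(** The mean value theorem on the segment gives the constant [L] instead of the sharp [L / 2],
    without integrating; the loss only affects the final constants. *)
Lemma lipschitz_grad_descent f x y (L : R) : 0 <= L ->
  (forall z, differentiable f z) ->
  (forall z w, l2norm (grad f z - grad f w) <= L * l2norm (z - w)) ->
  f y <= f x + dotv (grad f x) (y - x) + L * l2norm (y - x) ^+ 2.
Proof.
move=> L0 df lf; have [t /andP[t0 t1] ft] := grad_mvt x y df.
rewrite -addrA -lerBlDl ft -lerBlDl -dotvBl (le_trans (ler_dotv _ _)) //.
rewrite expr2 mulrA ler_wpM2r ?l2norm_ge0 // (le_trans (lf _ _)) //.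
rewrite ler_wpM2l // addrAC subrr add0r l2normZ ger0_norm //.
by rewrite ler_piMl ?l2norm_ge0.
Qed.

Section Mean.
Variables (n : nat) (f : 'I_n -> 'cV[R]_d -> R).

Lemma mean_funE : mean_fun f = n%:R^-1 *: \sum_(k < n) f k.
Proof. by apply/funext => x; rewrite /mean_fun fctE fct_sumE. Qed.

Lemma differentiable_mean x :
  (forall k, differentiable (f k) x) -> differentiable (mean_fun f) x.
Proof.
move=> df; rewrite mean_funE; apply: differentiableZ.
exact: differentiable_sum.
Qed.

Lemma grad_mean x : (forall k, differentiable (f k) x) ->
  grad (mean_fun f) x = n%:R^-1 *: \sum_(k < n) grad (f k) x.
Proof.
move=> df; have dv v k : derivable (f k) x v by exact: diff_derivable.
apply/colP => i; rewrite [LHS]mxE mean_funE deriveZ; last exact: derivable_sum.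
rewrite derive_sum // [RHS]mxE summxE.
by congr (_ * _); apply: eq_bigr => k _; rewrite mxE.
Qed.

Lemma l2norm_mean_le (I : finType) (B : {set I}) (F : I -> 'cV[R]_d) (c : R) :
  0 <= c -> (forall k, k \in B -> l2norm (F k) <= c) ->
  l2norm (#|B|%:R^-1 *: \sum_(k in B) F k) <= c.
Proof.
move=> c0 Fc; rewrite l2normZ ger0_norm ?invr_ge0 //.
(* An empty batch has mean [0], by the convention [0^-1 = 0]. *)
have [->|B0] := eqVneq #|B| 0%N; first by rewrite invr0 mul0r.
rewrite ler_pdivrMl ?ltr0n ?lt0n // (le_trans (ler_l2norm_sum _ _ _)) //.
by rewrite (le_trans (ler_sum _ Fc)) // sumr_const mulr_natl.
Qed.

Lemma batch_grad_lipschitz (B : {set 'I_n}) (L : R) x y : 0 <= L ->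
  (forall k, l2norm (grad (f k) x - grad (f k) y) <= L * l2norm (x - y)) ->
  l2norm (batch_grad f B x - batch_grad f B y) <= L * l2norm (x - y).
Proof.
move=> L0 Lf; rewrite /batch_grad -scalerBr -sumrB.
by apply: l2norm_mean_le => //; rewrite mulr_ge0 ?l2norm_ge0.
Qed.

Lemma batch_grad_le (B : {set 'I_n}) (G : R) x : 0 <= G ->
  (forall k, l2norm (grad (f k) x) <= G) -> l2norm (batch_grad f B x) <= G.
Proof. by move=> G0 fG; apply: l2norm_mean_le. Qed.

Lemma grad_mean_batch x : (forall k, differentiable (f k) x) ->
  grad (mean_fun f) x = batch_grad f [set: 'I_n] x.
Proof.
move=> df; rewrite grad_mean // /batch_grad cardsT card_ord.
by congr (_ *: _); apply: eq_bigl => k; rewrite inE.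
Qed.

End Mean.

End Calculus.

(** * Averages with weights t^(-1/2) *)

Section WeightedAverage.
Variable (R : realType).

Lemma powR_sqrtV (t : nat) : (t%:R : R) `^ (- 2^-1) = (Num.sqrt t%:R)^-1.
Proof. by rewrite powRN -powR12_sqrt. Qed.

(** By [ln (1 - 1 / k) <= - 1 / k], the logarithm grows by at least [1 / k] from [k - 1] to [k]. *)
Lemma harmonic_le_ln (T : nat) : (1 <= T)%N ->
  \sum_(2 <= t < T.+1) t%:R^-1 <= ln T%:R :> R.
Proof.
case: T => // T _; elim: T => [|T IH].
  by rewrite big_geq // ln1.
rewrite big_nat_recr //=; apply: le_trans (lerD IH (lexx _)) _.
have T1 : 0 < T.+1%:R :> R by rewrite ltr0n.
have T2 : 0 < T.+2%:R :> R by rewrite ltr0n.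
have xE : T.+1%:R = T.+2%:R * (1 + (- T.+2%:R^-1)) :> R.
  by rewrite mulrDr mulrN divff ?gt_eqF // mulr1 [in RHS]mulrS; ring.
have x1 : - 1 < - T.+2%:R^-1 :> R.
  by rewrite ltrN2 invf_lt1 // ltr1n.
have -> : ln (T.+1%:R : R) = ln T.+2%:R + ln (1 + (- T.+2%:R^-1)).
  by rewrite xE lnM // posrE -?(ltrBlDl) ?sub0r.
by rewrite -addrA gerDl -lerBrDr sub0r le_ln1Dx.
Qed.

Lemma sum_sqrtV_ge (T : nat) : (1 <= T)%N ->
  Num.sqrt T%:R <= \sum_(1 <= t < T.+1) (Num.sqrt t%:R)^-1 :> R.
Proof.
move=> T1; have sT : 0 < Num.sqrt T%:R :> R by rewrite sqrtr_gt0 ltr0n.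
have -> : Num.sqrt T%:R = \sum_(1 <= t < T.+1) (Num.sqrt T%:R)^-1 :> R.
  rewrite sumr_const_nat subSS subn0 -[RHS]mulr_natl.
  apply: (mulIf (lt0r_neq0 sT)).
  by rewrite divfK ?gt_eqF // -expr2 sqr_sqrtr // ler0n.
rewrite big_nat_cond [leRHS]big_nat_cond; apply: ler_sum => t.
rewrite andbT => /andP[t1 tT].
by rewrite lef_pV2 ?posrE ?sqrtr_gt0 ?ltr0n // ler_wsqrtr // ler_nat.
Qed.

(** Epoch 1 has weight 1 and is covered by [U]. From epoch 2 on, the values of [F] telescope and the
    errors [1 / t] add up to at most [ln T]. The total weight is at least [sqrt T]. *)
Lemma epoch_expectation_le (T : nat) (u F : nat -> R) (eta c E A U : R) :
  (1 <= T)%N -> 0 < eta -> 0 < c -> 0 <= E -> 0 <= U ->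
  (forall t, (1 <= t <= T)%N -> 0 <= u t) -> u 1%N <= U ->
  F 2 - F T.+1 <= A ->
  (forall t, (2 <= t <= T)%N ->
    eta * c * ((Num.sqrt t%:R)^-1 * u t) <= F t - F t.+1 + eta * E / t%:R) ->
  epoch_expectation T u <=
    (U + (A / eta + E * ln T%:R) / c) / Num.sqrt T%:R.
Proof.
move=> T1 eta0 c0 E0 U0 u0 u1 FA step.
have sT : 0 < Num.sqrt T%:R :> R by rewrite sqrtr_gt0 ltr0n.
rewrite /epoch_expectation; under eq_bigr do rewrite powR_sqrtV.
under [X in _ / X]eq_bigr do rewrite powR_sqrtV.
have num0 : 0 <= \sum_(1 <= i < T.+1) (Num.sqrt i%:R)^-1 * u i.
  rewrite big_nat_cond; apply: sumr_ge0 => i; rewrite andbT => i1.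
  by rewrite mulr_ge0 ?invr_ge0 ?sqrtr_ge0 ?u0.
have weighted_le : \sum_(1 <= i < T.+1) (Num.sqrt i%:R)^-1 * u i <=
    U + (A / eta + E * ln T%:R) / c.
  rewrite big_nat_recl // sqrtr1 invr1 mul1r lerD // big_add1 /=.
  rewrite ler_pdivlMr // -(ler_pM2l eta0) [leRHS]mulrDr.
  rewrite [eta * (A / _)]mulrCA divff ?gt_eqF // mulr1.
  have : \sum_(2 <= t < T.+1) eta * c * ((Num.sqrt t%:R)^-1 * u t) <=
      \sum_(2 <= t < T.+1) (F t - F t.+1 + eta * E / t%:R).
    rewrite big_nat_cond [leRHS]big_nat_cond; apply: ler_sum => t.
    by rewrite andbT => /step.
  rewrite -mulr_sumr big_split /=.
  have -> : \sum_(2 <= t < T.+1) (F t - F t.+1) = F 2 - F T.+1.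
    have := @telescope_sumr _ 2 T.+1 F T1 => /(congr1 -%R).
    by rewrite -sumrN opprB => <-; apply: eq_bigr => t _; rewrite opprB.
  rewrite -mulr_sumr 2!big_add1 /= => h.
  rewrite [X in eta * X]mulrC mulrA (le_trans h) // lerD // -mulrA.
  rewrite !ler_wpM2l ?(ltW eta0) //.
  by have := harmonic_le_ln T1; rewrite 2!big_add1.
rewrite ler_pdivrMr ?(lt_le_trans sT (sum_sqrtV_ge T1)) //.
(* The bound on the numerator must be nonnegative before the denominator is replaced by the smaller
   [sqrt T]. *)
have b0 := le_trans num0 weighted_le.
rewrite -mulrA (le_trans weighted_le) //.
by rewrite ler_peMr // mulrC ler_pdivlMr // mul1r sum_sqrtV_ge.
Qed.

End WeightedAverage.

(** * One epoch of SHAdaGrad *)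

Lemma outer_form (R : realType) (d i : nat) (H : 'M[R]_(d, i)) (v : 'cV[R]_d) :
  dotv v (H *m H^T *m v) = \sum_(j < i) dotv (col j H) v ^+ 2.
Proof.
have -> : dotv v (H *m H^T *m v) = dotv (H^T *m v) (H^T *m v).
  by rewrite /dotv trmx_mul trmxK !mulmxA.
rewrite dotvE; apply: eq_bigr => j _; rewrite -expr2; congr (_ ^+ 2).
by rewrite dotvE mxE; apply: eq_bigr => k _; rewrite !mxE.
Qed.

(** Equal sizes turn every weight [1 / |B_j|] into [m / n], and the batches partition the indices. A
    batch cannot be empty, since [n > 0]. *)
Lemma sum_batch_grad (R : realType) (d n m : nat)
    (f : 'I_n -> 'cV[R]_d -> R) (B : nat -> {set 'I_n}) (y : 'cV[R]_d) :
  (0 < n)%N -> equal_batches m B -> (forall k, differentiable (f k) y) ->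
  \sum_(1 <= j < m.+1) batch_grad f (B j) y = m%:R *: grad (mean_fun f) y.
Proof.
move=> n0 [Bpart Binj Bcard] df; rewrite big_add1 big_mkord.
have nm (j : 'I_m) : #|B j.+1|%:R^-1 = m%:R / n%:R :> R.
  have := Bcard j; have [->|B0] := eqVneq #|B j.+1| 0%N.
    by rewrite mul0n => n_eq0; rewrite -n_eq0 ltnn in n0.
  move=> /(congr1 (fun k : nat => k%:R : R)); rewrite natrM => <-.
  have m0 : (0 < m)%N by exact: leq_ltn_trans (ltn_ord j).
  by field; rewrite !pnatr_eq0 -!lt0n m0 lt0n B0.
rewrite (eq_bigr (fun j : 'I_m =>
    (m%:R / n%:R) *: \sum_(k in B j.+1) grad (f k) y)); last first.
  by move=> j _; rewrite /batch_grad nm.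
rewrite -scaler_sumr grad_mean // scalerA; congr (_ *: _).
have [/eqP Bcov Btriv _] := and3P Bpart.
(* Injectivity turns the sum over batch numbers into a sum over the blocks of the partition. *)
rewrite -(big_imset (fun A : {set 'I_n} => \sum_(k in A) grad (f k) y)) /=;
  last by move=> i j _ _; exact: Binj.
rewrite (_ : [set B (nat_of_ord j).+1 | j in 'I_m]%SET =
  [set B (nat_of_ord j).+1 | j : 'I_m]%SET) //.
rewrite -(finset.big_trivIset _ Btriv) Bcov.
by apply: eq_bigl => k; rewrite inE.
Qed.

Section Run.
Variables (R : realType) (n m d : nat) (Gamma L G csigma ckappa eta : R).
Variables (f : 'I_n -> 'cV[R]_d -> R) (T : nat) (delta : nat -> nat -> R).
Variables (B : nat -> nat -> {set 'I_n}) (x : nat -> nat -> 'cV[R]_d).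
Hypotheses (n_gt0 : (0 < n)%N) (m_gt0 : (0 < m)%N).
Hypotheses (L_gt0 : 0 < L) (G_gt0 : 0 < G) (csigma_gt0 : 0 < csigma).
Hypotheses (Gamma_gt0 : 0 < Gamma) (eta_gt0 : 0 < eta).
Hypothesis df : forall k y, differentiable (f k) y.
Hypothesis lipf : forall k y z,
  l2norm (grad (f k) y - grad (f k) z) <= L * l2norm (y - z).
Hypothesis boundf : forall k y, l2norm (grad (f k) y) <= G.
Hypothesis run : shadagrad_run m f csigma eta Gamma delta T B x.
Hypothesis cond : forall t, (1 <= t <= T)%N ->
  \rank (Hmx f B x t m) = m /\
  max_singular_value ((Hmx f B x t m)^T *m Hmx f B x t m) /
  min_singular_value ((Hmx f B x t m)^T *m Hmx f B x t m) <= ckappa.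
Hypothesis eta_le : eta <= csigma ^+ 2 / (16 * n%:R * L * G).
Hypothesis deltaE : forall i j, (1 <= i <= T)%N -> (1 <= j <= m)%N ->
  delta i j =
    \sum_(1 <= p < i) \sum_(1 <= q < m.+1) l2norm (step_grad f B x p q) ^+ 2
    + \sum_(1 <= q < j.+1) l2norm (step_grad f B x i q) ^+ 2.

Local Notation g := (step_grad f B x).
Local Notation Gt := (Gmx m f B x Gamma delta).
Local Notation S t i := (invsqrtmx (Gt t i)).
Local Notation F := (mean_fun f).

Let step_grad_le t i : l2norm (g t i) <= G.
Proof. by apply: batch_grad_le => //; exact: ltW. Qed.

Let step_grad_sq_le t i : l2norm (g t i) ^+ 2 <= G ^+ 2.
Proof. by rewrite ler_sqr ?nnegrE ?l2norm_ge0 ?(ltW G_gt0). Qed.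

Let mean_grad_le y : l2norm (grad F y) <= G.
Proof.
by rewrite grad_mean_batch //; apply: batch_grad_le => //; exact: ltW.
Qed.

Let lip_mean y z : l2norm (grad F y - grad F z) <= L * l2norm (y - z).
Proof.
by rewrite !grad_mean_batch //; apply: batch_grad_lipschitz => //; exact: ltW.
Qed.

(** * Quadratic form of [G_{i,t}] *)

Lemma Hmx_form t i v :
  dotv v (Hmx f B x t i *m (Hmx f B x t i)^T *m v) =
  \sum_(1 <= q < i.+1) dotv (g t q) v ^+ 2.
Proof.
rewrite outer_form big_add1 big_mkord; apply: eq_bigr => j _.
by congr (dotv _ v ^+ 2); apply/colP => k; rewrite !mxE.
Qed.

Lemma Gmx_form t i v : dotv v (Gt t i *m v) =
  \sum_(1 <= s < t) \sum_(1 <= q < m.+1) dotv (g s q) v ^+ 2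
  + \sum_(1 <= q < i.+1) dotv (g t q) v ^+ 2 + delta t i / Gamma * dotv v v.
Proof.
rewrite /Gmx !mulmxDl !dotvDr mul_scalar_mx dotvZr Hmx_form.
congr (_ + _ + _); rewrite mulmx_suml dotv_sumr.
by apply: eq_bigr => s _; rewrite Hmx_form.
Qed.

Let dotv_sq_le (u v : 'cV[R]_d) : dotv u v ^+ 2 <= l2norm u ^+ 2 * dotv v v.
Proof.
rewrite -(l2norm_sq v) -exprMn -[leLHS]real_normK ?num_real //.
by rewrite ler_sqr ?nnegrE ?mulr_ge0 ?l2norm_ge0 // ler_norm_dotv.
Qed.

Let sum_step_le t (r : seq nat) :
  \sum_(q <- r) l2norm (g t q) ^+ 2 <= (size r)%:R * G ^+ 2.
Proof.
rewrite -sum1_size natr_sum mulr_suml; apply: ler_sum => q _.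
by rewrite mul1r.
Qed.

Lemma delta_le t i : (1 <= t <= T)%N -> (1 <= i <= m)%N ->
  delta t i <= t%:R * (m%:R * G ^+ 2).
Proof.
move=> tT im; rewrite deltaE //.
have /andP[t1 _] := tT; have /andP[i1 im'] := im.
apply: (@le_trans _ _ (\sum_(1 <= s < t) (m%:R * G ^+ 2) + m%:R * G ^+ 2)).
  apply: lerD; first apply: ler_sum => s _.
    by apply: le_trans (sum_step_le _ _) _; rewrite size_iota subSS subn0.
  apply: le_trans (sum_step_le _ _) _; rewrite size_iota subSS subn0.
  by rewrite ler_wpM2r ?sqr_ge0 // ler_nat.
rewrite sumr_const_nat -[X in X + _ <= _]mulr_natl -[X in _ + X <= _]mul1r.
by rewrite -mulrDl natr1 subn1 prednK.
Qed.

(** Each [<g, v>^2] is at most [|g|^2 |v|^2], and the [|g|^2] add up to [delta]; the perturbation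
    contributes the [Gamma^-1]. *)
Lemma Gmx_form_le_delta t i v : (1 <= t <= T)%N -> (1 <= i <= m)%N ->
  dotv v (Gt t i *m v) <= (1 + Gamma^-1) * delta t i * dotv v v.
Proof.
move=> tT im; rewrite Gmx_form mulrDl mul1r mulrDl.
rewrite (mulrC Gamma^-1) lerD2r deltaE // mulrDl lerD // mulr_suml.
  by apply: ler_sum => s _; rewrite mulr_suml; apply: ler_sum.
by apply: ler_sum.
Qed.

Lemma Gmx_form_ge t i v :
  delta t i / Gamma * dotv v v <= dotv v (Gt t i *m v).
Proof.
rewrite Gmx_form lerDr addr_ge0 //.
  by apply: sumr_ge0 => s _; apply: sumr_ge0 => q _; exact: sqr_ge0.
by apply: sumr_ge0 => q _; exact: sqr_ge0.
Qed.

(** The outer square of the current gradient is a summand of [G_{i,t}] and the rest is positive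
    semidefinite. This bounds every step by [eta], including those of epoch 1. *)
Lemma step_grad_form_le t i v : (1 <= t <= T)%N -> (1 <= i <= m)%N ->
  dotv (g t i) v ^+ 2 <= dotv v (Gt t i *m v).
Proof.
move=> tT im; rewrite Gmx_form.
have /andP[i1 _] := im.
rewrite big_nat_recr //=.
have h1 : 0 <= \sum_(1 <= s < t) \sum_(1 <= q < m.+1) dotv (g s q) v ^+ 2.
  by apply: sumr_ge0 => s _; apply: sumr_ge0 => q _; exact: sqr_ge0.
have h2 : 0 <= \sum_(1 <= q < i) dotv (g t q) v ^+ 2.
  by apply: sumr_ge0 => q _; exact: sqr_ge0.
have h3 : 0 <= delta t i / Gamma * dotv v v.
  rewrite mulr_ge0 ?dotvv_ge0 // divr_ge0 ?(ltW Gamma_gt0) //.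
  exact: (run_delta_ge0 run).
lra.
Qed.

Let Gmx_posdef t i : (1 <= t <= T)%N -> (1 <= i <= m)%N -> posdefmx (Gt t i).
Proof. exact: (run_posdef run). Qed.

Let invsqrt_posdef t i : (1 <= t <= T)%N -> (1 <= i <= m)%N -> posdefmx (S t i).
Proof. by move=> tT im; case: (invsqrtmxP (Gmx_posdef tT im)). Qed.

Let invsqrt_sq t i : (1 <= t <= T)%N -> (1 <= i <= m)%N ->
  S t i *m S t i = invmx (Gt t i).
Proof. by move=> tT im; case: (invsqrtmxP (Gmx_posdef tT im)). Qed.

(** * Drift of the iterates within an epoch *)

Lemma direction_le1 t i : (1 <= t <= T)%N -> (1 <= i <= m)%N ->
  l2norm (S t i *m g t i) <= 1.
Proof.
move=> tT im; have [Ss _] := invsqrt_posdef tT im.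
apply: invsqrt_norm_le1 (Gmx_posdef tT im) Ss (invsqrt_sq tT im) _ => w.
exact: step_grad_form_le.
Qed.

(** The bound [c] is a parameter because it is used with [c = 1] in every epoch and with [c] of
    order [t^{-1/2}] from epoch 2 on. *)
Lemma epoch_drift t c i : (1 <= t <= T)%N ->
  (forall j, (1 <= j <= m)%N -> l2norm (S t j *m g t j) <= c) -> (i <= m)%N ->
  l2norm (x t i.+1 - x t 1%N) <= i%:R * (eta * c).
Proof.
move=> tT hc; elim: i => [|i IH] im; first by rewrite subrr l2norm0 mul0r.
rewrite (run_step run) // addrAC.
apply: le_trans (ler_l2normB _ _) _.
rewrite -natr1 mulrDl mul1r lerD ?IH ?(ltnW im) //.
by rewrite l2normZ gtr0_norm // ler_wpM2l ?(ltW eta_gt0) ?hc.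
Qed.

(** Roles of the constants: an epoch adds at least [a] to [delta]; the form of [G_{i,t}] is at most
    [K t] and, for [t >= 2], at least [a / (2 Gamma) t]; then [G_{i,t}^{-1/2}] has norm at most
    [p / sqrt t] and varies by at most [P / t] in the epoch; the mean gradient along an epoch has
    norm at least [b]; [eta0] is the largest allowed step size. *)
Variables (a K p P b eta0 : R).
Hypothesis a_def : a = csigma ^+ 2 * m%:R ^+ 2 / (16 * n%:R).
Hypothesis K_def : K = (1 + Gamma^-1) * (m%:R * G ^+ 2).
Hypothesis p_def : p = (Num.sqrt (a / (2 * Gamma)))^-1.
Hypothesis P_def :
  P = Num.sqrt (d%:R * (K ^+ 3 / (4 * (a / (2 * Gamma)) ^+ 4))).
Hypothesis b_def : b = Num.sqrt (a / ckappa) / m%:R.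
Hypothesis eta0_def : eta0 = csigma ^+ 2 / (16 * n%:R * L * G).

Let mR_gt0 : 0 < m%:R :> R. Proof. by rewrite ltr0n. Qed.
Let nR_gt0 : 0 < n%:R :> R. Proof. by rewrite ltr0n. Qed.

Let a_gt0 : 0 < a.
Proof. by rewrite a_def divr_gt0 ?mulr_gt0 ?exprn_gt0. Qed.

Let K_gt0 : 0 < K.
Proof.
by rewrite K_def !mulr_gt0 ?exprn_gt0 // addr_gt0 ?invr_gt0 ?ltr01.
Qed.

Let k_gt0 : 0 < a / (2 * Gamma).
Proof. by rewrite divr_gt0 // mulr_gt0. Qed.

Let p_gt0 : 0 < p.
Proof. by rewrite p_def invr_gt0 sqrtr_gt0. Qed.

Let eta_le0 : eta <= eta0.
Proof. by rewrite eta0_def. Qed.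

Let sum_nat_le_sq (k : nat) : 2 * \sum_(j < k) (j : nat)%:R <= k%:R ^+ 2 :> R.
Proof.
elim: k => [|k IH]; first by rewrite big_ord0 mulr0 expr0n.
rewrite big_ord_recr /= mulrDr -[k.+1%:R]natr1 sqrrD1.
by have : (0 : R) <= k%:R by []; lra.
Qed.

(** The test at [x_1^t] guarantees [2 a]. After a drift of at most [j eta], a squared gradient norm
    has lost at most [2 G L eta j], hence at most [G L eta m^2] in total over the epoch. *)
Lemma epoch_grad_sq_ge t : (1 <= t <= T)%N ->
  a <= \sum_(1 <= j < m.+1) l2norm (g t j) ^+ 2.
Proof.
move=> tT; have acc := run_accepted run tT.
have drift (j : 'I_m) : l2norm (x t j.+1 - x t 1%N) <= j%:R * (eta * 1).
  by apply: epoch_drift => // [i im|]; [exact: direction_le1|exact/ltnW].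
rewrite [leRHS]big_add1 big_mkord /= in acc.
rewrite [leRHS]big_add1 big_mkord /=.
have term (j : 'I_m) : l2norm (batch_grad f (B t j.+1) (x t 1%N)) ^+ 2 <=
    l2norm (g t j.+1) ^+ 2 + G * L * eta * (2 * j%:R).
  set u := batch_grad _ _ _.
  have uG : l2norm u <= G by apply: batch_grad_le => //; exact: ltW.
  have gG := step_grad_le t j.+1.
  have ug : l2norm u <= l2norm (g t j.+1) + L * (j%:R * eta).
    rewrite -lerBlDl; apply: (@le_trans _ _ (l2norm (g t j.+1 - u))).
      rewrite lerBlDl.
      have {1}-> : u = g t j.+1 - (g t j.+1 - u) by rewrite subKr.
      by rewrite (le_trans (ler_l2normB _ _)).
    apply: le_trans (batch_grad_lipschitz _ (ltW L_gt0) _) _ => [k|].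
      exact: lipf.
    by rewrite ler_wpM2l ?(ltW L_gt0) // (le_trans (drift j)) // mulr1.
  have e0 : 0 <= L * (j%:R * eta)
    by rewrite !mulr_ge0 ?(ltW L_gt0) ?(ltW eta_gt0).
  have u0 := l2norm_ge0 u; have g0 := l2norm_ge0 (g t j.+1).
  have -> : G * L * eta * (2 * j%:R) = 2 * G * (L * (j%:R * eta)) by ring.
  move: (l2norm u) (l2norm (g t j.+1)) (L * _) uG gG ug e0 u0 g0.
  move=> y z e yG zG yze e0 y0 z0.
  have [yz|/ltW zy] := leP y z.
    have : y ^+ 2 <= z ^+ 2 by rewrite ler_sqr ?nnegrE.
    have : 0 <= 2 * G * e by rewrite !mulr_ge0 // ltW.
    lra.
  have : (y - z) * (y + z) <= e * (2 * G).
    by rewrite ler_pM ?subr_ge0 ?addr_ge0 //; lra.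
  lra.
have : \sum_(j < m) l2norm (batch_grad f (B t j.+1) (x t 1%N)) ^+ 2 <=
    \sum_(j < m) (l2norm (g t j.+1) ^+ 2 + G * L * eta * (2 * j%:R)).
  by apply: ler_sum.
rewrite big_split /= -mulr_sumr -mulr_sumr => h.
have GLe0 : 0 <= G * L * eta by rewrite !mulr_ge0 ?ltW.
(* The step size condition is exactly the one that keeps this loss below [a]. *)
have GLe : G * L * eta * m%:R ^+ 2 <= a.
  have -> : a = csigma ^+ 2 / (16 * n%:R) * m%:R ^+ 2.
    by rewrite a_def; field; rewrite gt_eqF.
  rewrite ler_wpM2r ?sqr_ge0 //.
  have -> : csigma ^+ 2 / (16 * n%:R) =
      G * L * (csigma ^+ 2 / (16 * n%:R * L * G)).
    by field; rewrite !gt_eqF.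
  by rewrite ler_wpM2l // mulr_ge0 ?ltW.
have := ler_wpM2l GLe0 (sum_nat_le_sq m).
have a2 : csigma ^+ 2 * m%:R ^+ 2 / (8 * n%:R) = a + a.
  by rewrite a_def; field; rewrite gt_eqF.
rewrite a2 in acc; lra.
Qed.

(** The [t - 1] completed epochs give [a (t - 1)], which is at least [a t / 2] once [t >= 2]. Epoch
    1 has no completed epoch behind it and is treated apart. *)
Lemma delta_ge t i : (2 <= t <= T)%N -> (1 <= i <= m)%N ->
  a / 2 * t%:R <= delta t i.
Proof.
move=> /andP[t2 tT] im; have t1 : (1 <= t)%N by apply: leq_trans t2.
rewrite deltaE ?t1 //.
have h1 : 0 <= \sum_(1 <= q < i.+1) l2norm (g t q) ^+ 2.
  by apply: sumr_ge0 => q _; exact: sqr_ge0.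
have h2 : \sum_(1 <= s < t) a <=
    \sum_(1 <= s < t) \sum_(1 <= q < m.+1) l2norm (g s q) ^+ 2.
  rewrite big_nat_cond [leRHS]big_nat_cond; apply: ler_sum => s.
  rewrite andbT => /andP[s1 st]; apply: epoch_grad_sq_ge.
  by rewrite s1 (leq_trans (ltnW st)).
rewrite sumr_const_nat -mulr_natl natrB // in h2.
have t2R : 2 <= t%:R :> R by rewrite ler_nat.
have := ler_wpM2l (ltW a_gt0) t2R; lra.
Qed.

Lemma Gmx_form_ge_epoch t i v : (2 <= t <= T)%N -> (1 <= i <= m)%N ->
  a / (2 * Gamma) * t%:R * dotv v v <= dotv v (Gt t i *m v).
Proof.
move=> tT im; apply: le_trans (Gmx_form_ge _ _ _).
rewrite ler_wpM2r ?dotvv_ge0 // ler_pdivlMr //.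
rewrite (_ : a / (2 * Gamma) * t%:R * Gamma = a / 2 * t%:R); last first.
  by field; rewrite gt_eqF.
exact: delta_ge.
Qed.

Lemma Gmx_form_le_epoch t i v : (1 <= t <= T)%N -> (1 <= i <= m)%N ->
  dotv v (Gt t i *m v) <= K * t%:R * dotv v v.
Proof.
move=> tT im; apply: le_trans (Gmx_form_le_delta _ tT im) _.
rewrite ler_wpM2r ?dotvv_ge0 // K_def -mulrA ler_wpM2l //.
  by rewrite addr_ge0 ?invr_ge0 ?ler01 // ltW.
by rewrite mulrC delta_le.
Qed.

Let epoch_gt0 t : (2 <= t <= T)%N -> (1 <= t <= T)%N.
Proof. by case/andP=> t2 ->; rewrite (leq_trans _ t2). Qed.

Lemma invsqrt_le_epoch t i v : (2 <= t <= T)%N -> (1 <= i <= m)%N ->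
  l2norm (S t i *m v) <= p * (Num.sqrt t%:R)^-1 * l2norm v.
Proof.
move=> tT im; have tT1 := epoch_gt0 tT.
have tR : 0 < t%:R :> R by rewrite ltr0n; case/andP: tT1.
have [Ss _] := invsqrt_posdef tT1 im.
have kt : 0 < a / (2 * Gamma) * t%:R by rewrite mulr_gt0.
have := invsqrt_norm_le v (Gmx_posdef tT1 im) Ss (invsqrt_sq tT1 im) kt
  (fun w => Gmx_form_ge_epoch w tT im).
move=> h; rewrite p_def -invfM -sqrtrM ?(ltW k_gt0) //.
rewrite ler_pdivlMl ?sqrtr_gt0 //.
rewrite -ler_sqr ?nnegrE ?mulr_ge0 ?l2norm_ge0 ?sqrtr_ge0 //.
by rewrite exprMn (sqr_sqrtr (ltW kt)).
Qed.

(** Only iterations [i + 1] to [m] of the current epoch remain in the difference, both in the outer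
    squares and in [delta], so the bound does not grow with [t]. *)
Lemma Gmx_increment_form t i v : (1 <= t <= T)%N -> (1 <= i <= m)%N ->
  0 <= dotv v ((Gt t m - Gt t i) *m v) <= K * dotv v v.
Proof.
move=> tT im; have mm : (1 <= m <= m)%N by rewrite m_gt0 leqnn.
rewrite mulmxBl dotvBr !Gmx_form !deltaE //.
have /andP[i1 im'] := im.
have tail (E : nat -> R) : \sum_(1 <= q < m.+1) E q =
    \sum_(1 <= q < i.+1) E q + \sum_(i.+1 <= q < m.+1) E q.
  by rewrite (@big_cat_nat _ _ _ i.+1).
set D := \sum_(1 <= s < t) _; set D' := \sum_(1 <= s < t) _.
rewrite !tail; set X := \sum_(1 <= q < i.+1) _; set Y := \sum_(1 <= q < i.+1) _.
set X' := \sum_(i.+1 <= q < m.+1) _; set Y' := \sum_(i.+1 <= q < m.+1) _.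
have -> : D + (X + X') + (D' + (Y + Y')) / Gamma * dotv v v
    - (D + X + (D' + Y) / Gamma * dotv v v) = X' + Y' / Gamma * dotv v v.
  by field; rewrite gt_eqF.
have X'0 : 0 <= X' by apply: sumr_ge0 => q _; exact: sqr_ge0.
have Y'0 : 0 <= Y' by apply: sumr_ge0 => q _; exact: sqr_ge0.
have Y'le : Y' <= m%:R * G ^+ 2.
  apply: le_trans (sum_step_le _ _) _; rewrite size_iota.
  by rewrite ler_wpM2r ?sqr_ge0 // ler_nat subSS leq_subr.
have X'le : X' <= m%:R * G ^+ 2 * dotv v v.
  apply: (@le_trans _ _ (Y' * dotv v v)); last by rewrite ler_wpM2r ?dotvv_ge0.
  by rewrite mulr_suml; apply: ler_sum.
apply/andP; split.
  by rewrite addr_ge0 // mulr_ge0 ?dotvv_ge0 // divr_ge0 // ltW.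
rewrite K_def mulrDl mul1r mulrDl lerD // ler_wpM2r ?dotvv_ge0 //.
by rewrite mulrC ler_wpM2l ?invr_ge0 ?(ltW Gamma_gt0).
Qed.

(** In [invsqrt_perturbation] take an increment [K] between matrices of order [t]: the squared bound
    is [P^2 / t^3] times [|v|^2], which is relaxed to [P^2 / t^2]. *)
Lemma invsqrt_drift t i v : (2 <= t <= T)%N -> (1 <= i <= m)%N ->
  l2norm ((S t i - S t m) *m v) <= P / t%:R * l2norm v.
Proof.
move=> tT im; have tT1 := epoch_gt0 tT.
have mm : (1 <= m <= m)%N by rewrite m_gt0 leqnn.
have tR : 0 < t%:R :> R by rewrite ltr0n; case/andP: tT1.
have P0 : 0 <= P by rewrite P_def sqrtr_ge0.
rewrite -ler_sqr ?nnegrE ?mulr_ge0 ?divr_ge0 ?l2norm_ge0 ?(ltW tR) //.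
have kt : 0 < a / (2 * Gamma) * t%:R by rewrite mulr_gt0.
have Kt : 0 < K * t%:R by rewrite mulr_gt0.
have := invsqrt_perturbation v (Gmx_posdef tT1 im) (Gmx_posdef tT1 mm)
  (invsqrt_posdef tT1 im) (invsqrt_posdef tT1 mm) (invsqrt_sq tT1 im)
  (invsqrt_sq tT1 mm) kt Kt (fun w => Gmx_form_ge_epoch w tT im)
  (fun w => Gmx_form_le_epoch w tT1 mm)
  (fun w => proj1 (andP (Gmx_increment_form w tT1 im)))
  (fun w => proj2 (andP (Gmx_increment_form w tT1 im))).
move/le_trans; apply; rewrite [leRHS]exprMn ler_wpM2r ?sqr_ge0 //.
have k4 : 0 < 4 * (a / (2 * Gamma)) ^+ 4 by rewrite mulr_gt0 ?exprn_gt0.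
have PP : P ^+ 2 = d%:R * (K ^+ 3 / (4 * (a / (2 * Gamma)) ^+ 4)).
  rewrite P_def sqr_sqrtr // mulr_ge0 // divr_ge0 ?ltW //.
  by rewrite exprn_gt0.
rewrite [leRHS]exprMn PP -[leRHS]mulrA ler_wpM2l //.
clear kt PP; move: (a / (2 * Gamma)) k_gt0 k4 => k k0 k4.
rewrite !exprMn (sqr_sqrtr (ltW Kt)).
rewrite [leLHS](_ : _ =
    K ^+ 3 / (4 * k ^+ 4) * t%:R^-1 ^+ 2 * t%:R^-1); last first.
  by field; rewrite !gt_eqF.
rewrite ler_piMr //; last by rewrite invf_le1 // ler1n; case/andP: tT1.
by rewrite !mulr_ge0 ?invr_ge0 ?exprn_ge0 ?invr_ge0
  ?(ltW k4) ?(ltW tR) ?(ltW K_gt0).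
Qed.

Lemma epoch_drift_sqrt t i : (2 <= t <= T)%N -> (i <= m)%N ->
  l2norm (x t i.+1 - x t 1%N) <= m%:R * (eta * (p * (Num.sqrt t%:R)^-1 * G)).
Proof.
move=> tT im; have tT1 := epoch_gt0 tT.
have c0 : 0 <= p * (Num.sqrt t%:R)^-1.
  by rewrite mulr_ge0 ?invr_ge0 ?sqrtr_ge0 // ltW.
apply: (@le_trans _ _ (i%:R * (eta * (p * (Num.sqrt t%:R)^-1 * G)))).
  apply: epoch_drift => // j jm; apply: le_trans (invsqrt_le_epoch _ tT jm) _.
  exact: ler_wpM2l.
rewrite ler_wpM2r ?ler_nat //.
by rewrite mulr_ge0 ?(ltW eta_gt0) // mulr_ge0 ?(ltW G_gt0).
Qed.

Lemma epoch_grad_near t : (2 <= t <= T)%N ->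
  l2norm (\sum_(1 <= j < m.+1) g t j - m%:R *: grad F (x t 1%N)) <=
  m%:R * (L * eta0 * m%:R * p * G * (Num.sqrt t%:R)^-1).
Proof.
move=> tT; have tT1 := epoch_gt0 tT.
rewrite -(sum_batch_grad n_gt0 (run_batches run tT1)) // -sumrB.
rewrite big_add1 big_mkord /=; apply: le_trans (ler_l2norm_sum _ _ _) _.
rewrite mulr_natl -[X in _ *+ X]card_ord -sumr_const; apply: ler_sum => j _.
apply: le_trans (batch_grad_lipschitz _ (ltW L_gt0) _) _ => [k|].
  exact: lipf.
have := epoch_drift_sqrt tT (ltnW (ltn_ord j)).
move/(ler_wpM2l (ltW L_gt0))/le_trans; apply.
(* One factor [eta] is replaced by [eta0], to make the constant independent of [eta]. *)
rewrite [leLHS](_ : _ =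
    eta * (L * m%:R * p * G * (Num.sqrt t%:R)^-1)); last by ring.
rewrite [leRHS](_ : _ =
    eta0 * (L * m%:R * p * G * (Num.sqrt t%:R)^-1)); last by ring.
by rewrite ler_wpM2r // !mulr_ge0 ?invr_ge0 ?sqrtr_ge0
  ?(ltW L_gt0) ?(ltW p_gt0) ?(ltW G_gt0).
Qed.

(** Condition (B) gives [a <= ckappa |h|^2] for the sum [h] of the gradients. As [a > 0], this also
    yields the sign of [ckappa]. *)
Lemma epoch_grad_sum_ge t : (1 <= t <= T)%N ->
  0 < ckappa /\ m%:R * b <= l2norm (\sum_(1 <= j < m.+1) g t j).
Proof.
move=> tT; have [rk ck] := cond tT.
have := sum_col_norm_ge rk ck.
have colE (j : 'I_m) : col j (Hmx f B x t m) = g t j.+1.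
  by apply/colP => k; rewrite !mxE.
rewrite (eq_bigr (fun j : 'I_m => l2norm (g t j.+1) ^+ 2)) => [|j _].
  2: by rewrite colE.
rewrite [in X in _ * X](eq_bigr (fun j : 'I_m => g t j.+1)) => [|j _].
  2: exact: colE.
have := epoch_grad_sq_ge tT; rewrite big_add1 big_mkord /= => ag gk.
rewrite big_add1 big_mkord /=; set h := \sum_(j < m) g t j.+1 in gk *.
have akh := le_trans ag gk.
have ckh : 0 < ckappa * l2norm h ^+ 2 := lt_le_trans a_gt0 akh.
have k0 : 0 < ckappa.
  rewrite ltNge; apply/negP => k0; move: ckh; rewrite ltNge => /negP; apply.
  by rewrite mulr_le0_ge0 ?sqr_ge0.
split=> //; rewrite b_def mulrC divfK ?gt_eqF //.
rewrite -[leRHS]ger0_norm ?l2norm_ge0 // -sqrtr_sqr ler_wsqrtr //.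
by rewrite ler_pdivrMr // mulrC.
Qed.


(** * Descent of [f] over one epoch *)

Let D := L * eta0 * m%:R * p * G.

Lemma epoch_displacement t i : (1 <= t <= T)%N -> (i <= m)%N ->
  x t i.+1 - x t 1%N = - (eta *: \sum_(1 <= j < i.+1) S t j *m g t j).
Proof.
move=> tT; elim: i => [|i IH] im.
  by rewrite big_geq // scaler0 subrr oppr0.
rewrite (run_step run) // addrAC IH ?(ltnW im) // [in RHS]big_nat_recr //=.
by rewrite scalerDr opprD.
Qed.

(** Freeze the matrix at its last value [S t m] and the gradients at [x_1^t]. The main term is the
    form of [S t m] at the full gradient; each of the two errors is of order [1 / t]. *)
Lemma epoch_inner_ge t : (2 <= t <= T)%N ->
  m%:R / Num.sqrt K * (Num.sqrt t%:R)^-1 * l2norm (grad F (x t 1%N)) ^+ 2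
    - (G * p * m%:R * D + m%:R * G ^+ 2 * P) / t%:R <=
  dotv (grad F (x t 1%N)) (\sum_(1 <= j < m.+1) S t j *m g t j).
Proof.
move=> tT; set w := grad F _; have tT1 := epoch_gt0 tT.
have mm : (1 <= m <= m)%N by rewrite m_gt0 leqnn.
have tR : 0 < t%:R :> R by rewrite ltr0n; case/andP: tT1.
have Kt : 0 < K * t%:R by rewrite mulr_gt0.
set r := (Num.sqrt t%:R)^-1.
have r0 : 0 < r by rewrite invr_gt0 sqrtr_gt0.
have rr : t%:R^-1 = r * r by rewrite -expr2 exprVn (sqr_sqrtr (ltW tR)).
have D0 : 0 < D by rewrite !mulr_gt0 // (lt_le_trans eta_gt0).
have P0 : 0 <= P by rewrite P_def sqrtr_ge0.
have N0 := l2norm_ge0 w; have NG : l2norm w <= G := mean_grad_le _.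
set h := \sum_(1 <= j < m.+1) g t j.
have split_sum : \sum_(1 <= j < m.+1) S t j *m g t j =
    m%:R *: (S t m *m w) + S t m *m (h - m%:R *: w)
    + \sum_(1 <= j < m.+1) (S t j - S t m) *m g t j.
  rewrite mulmxBr -scalemxAr [X in X + _]addrC subrK.
  rewrite mulmx_sumr -big_split /=; apply: eq_bigr => j _.
  by rewrite mulmxBl addrC subrK.
rewrite split_sum !dotvDr dotvZr dotv_sumr.
have main : (Num.sqrt K)^-1 * r * l2norm w ^+ 2 <= dotv w (S t m *m w).
  have := invsqrt_form_ge w (Gmx_posdef tT1 mm) (invsqrt_posdef tT1 mm)
    (invsqrt_sq tT1 mm) Kt (fun v => Gmx_form_le_epoch v tT1 mm).
  by rewrite sqrtrM ?(ltW K_gt0) // invfM l2norm_sq.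
have err1 : - (G * (p * r * (m%:R * (D * r)))) <=
    dotv w (S t m *m (h - m%:R *: w)).
  rewrite lerNl -dotvNl; apply: le_trans (ler_dotv _ _) _.
  rewrite l2normN ler_pM ?l2norm_ge0 //.
  apply: le_trans (invsqrt_le_epoch _ tT mm) _.
  by rewrite ler_wpM2l ?epoch_grad_near // mulr_ge0 ?(ltW p_gt0) ?(ltW r0).
have err2 : - (m%:R * (G * (P / t%:R * G))) <=
    \sum_(1 <= j < m.+1) dotv w ((S t j - S t m) *m g t j).
  rewrite lerNl -sumrN big_add1 big_mkord /=.
  rewrite mulr_natl -[X in _ *+ X]card_ord -sumr_const; apply: ler_sum => j _.
  rewrite -dotvNl; apply: le_trans (ler_dotv _ _) _.
  rewrite l2normN ler_pM ?l2norm_ge0 //.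
  apply: le_trans (invsqrt_drift _ tT _) _; first by rewrite ltn_ord.
  by rewrite ler_wpM2l // divr_ge0 // ltW.
have := ler_wpM2l (ltW mR_gt0) main.
rewrite rr in err2 *; lra.
Qed.

Lemma epoch_grad_lower t : (2 <= t <= T)%N ->
  b <= l2norm (grad F (x t 1%N)) + D * (Num.sqrt t%:R)^-1.
Proof.
move=> tT; have [_ hb] := epoch_grad_sum_ge (epoch_gt0 tT).
rewrite -(ler_pM2l mR_gt0); apply: le_trans hb _.
set h := \sum_(1 <= j < m.+1) _; set w := grad F _.
rewrite -[h](subrK (m%:R *: w)); apply: le_trans (ler_l2normD _ _) _.
rewrite mulrDr addrC l2normZ gtr0_norm // lerD2l.
exact: epoch_grad_near.
Qed.

(** The squared gradient norm [N^2] of [epoch_inner_ge] becomes a first power through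
    [N >= b - D / sqrt t], at the price of an error of order [1 / t]. *)
Lemma epoch_descent t : (2 <= t <= T)%N ->
  eta * (m%:R / Num.sqrt K * b)
    * ((Num.sqrt t%:R)^-1 * l2norm (grad F (x t 1%N))) <=
  F (x t 1%N) - F (x t.+1 1%N) +
  eta * (m%:R / Num.sqrt K * D * G + (G * p * m%:R * D + m%:R * G ^+ 2 * P)
         + L * eta0 * (m%:R * p * G) ^+ 2) / t%:R.
Proof.
move=> tT; have tT1 := epoch_gt0 tT.
have tR : 0 < t%:R :> R by rewrite ltr0n; case/andP: tT1.
have inner := epoch_inner_ge tT.
have lower := epoch_grad_lower tT.
have desc := lipschitz_grad_descent (x t 1%N) (x t.+1 1%N) (ltW L_gt0)
  (fun z => differentiable_mean (fun k => df k z)) lip_mean.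
have drift := epoch_drift_sqrt tT (leqnn m).
rewrite (run_epoch run tT1) in desc *.
have dispE := epoch_displacement tT1 (leqnn m).
rewrite [in X in dotv _ X]dispE dotvNr dotvZr in desc.
have N0 := l2norm_ge0 (grad F (x t 1%N)).
have NG : l2norm (grad F (x t 1%N)) <= G := mean_grad_le _.
move: (dotv _ _) (l2norm (grad F _)) inner lower desc N0 NG => u N.
have sq : l2norm (x t m.+1 - x t 1%N) ^+ 2 <=
    (m%:R * (eta * (p * (Num.sqrt t%:R)^-1 * G))) ^+ 2.
  by rewrite ler_sqr ?nnegrE ?l2norm_ge0 // (le_trans (l2norm_ge0 _) drift).
move: sq; set r := (Num.sqrt t%:R)^-1.
have r0 : 0 < r by rewrite invr_gt0 sqrtr_gt0.
have -> : t%:R^-1 = r ^+ 2 by rewrite exprVn (sqr_sqrtr (ltW tR)).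
set q := m%:R / Num.sqrt K.
have q0 : 0 < q by rewrite divr_gt0 // sqrtr_gt0.
have D0 : 0 < D by rewrite !mulr_gt0 // (lt_le_trans eta_gt0).
set W := _ + m%:R * G ^+ 2 * P.
move=> sq inner lower desc N0 NG.
have h1 := ler_wpM2l (ltW eta_gt0) inner.
(* This is [N^2 >= N (b - D r)] with its weights; [h3] then replaces the remaining [N] by [G]. *)
have h2 : 0 <= eta * (q * r * N * (N + D * r - b)).
  rewrite mulr_ge0 ?(ltW eta_gt0) // !mulr_ge0 ?(ltW q0) ?(ltW r0) //.
  by rewrite subr_ge0.
have h3 : 0 <= eta * (q * D * r ^+ 2 * (G - N)).
  have qDr : 0 < q * D * r ^+ 2 by rewrite mulr_gt0 ?exprn_gt0 // mulr_gt0.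
  by rewrite mulr_ge0 ?(ltW eta_gt0) // mulr_ge0 ?subr_ge0 ?(ltW qDr).
have h4 := ler_wpM2l (ltW L_gt0) sq.
(* The quadratic term of the descent inequality carries [eta^2], which is bounded by
   [eta0 * eta]. *)
have h5 : 0 <= (eta0 - eta) * (eta * (L * (m%:R * p * G) ^+ 2 * r ^+ 2)).
  rewrite mulr_ge0 ?subr_ge0 // mulr_ge0 ?(ltW eta_gt0) //.
  by rewrite mulr_ge0 ?sqr_ge0 // mulr_ge0 ?sqr_ge0 ?(ltW L_gt0).
lra.
Qed.

(** Here only the step bound [eta] is available. The possible increase of [f] is proportional to
    [eta], so it stays bounded after the later division by [eta]. *)
Lemma first_epoch_descent : (1 <= T)%N ->
  F (x 2 1%N) - F (x 1%N 1%N) <= eta * (m%:R * G + L * eta0 * m%:R ^+ 2).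
Proof.
move=> T1; have tT1 : (1 <= 1 <= T)%N by rewrite leqnn.
have desc := lipschitz_grad_descent (x 1%N 1%N) (x 2 1%N) (ltW L_gt0)
  (fun z => differentiable_mean (fun k => df k z)) lip_mean.
have drift := epoch_drift tT1 (fun j jm => direction_le1 tT1 jm) (leqnn m).
rewrite mulr1 -(run_epoch run tT1) in drift.
have sq : l2norm (x 2 1%N - x 1%N 1%N) ^+ 2 <= (m%:R * eta) ^+ 2.
  by rewrite ler_sqr ?nnegrE ?l2norm_ge0 // (le_trans (l2norm_ge0 _) drift).
have h1 : dotv (grad F (x 1%N 1%N)) (x 2 1%N - x 1%N 1%N) <= G * (m%:R * eta).
  by apply: le_trans (ler_dotv _ _) _; rewrite ler_pM ?l2norm_ge0.
have h4 := ler_wpM2l (ltW L_gt0) sq.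
have h5 : 0 <= (eta0 - eta) * (eta * (L * m%:R ^+ 2)).
  by rewrite mulr_ge0 ?subr_ge0 // !mulr_ge0 ?(ltW eta_gt0) ?(ltW L_gt0).
lra.
Qed.

End Run.

(** * Summation over the epochs *)

Theorem theorem5p1 (R : realType) (n m d : nat)
    (Gamma L G csigma ckappa Delta : R)
    (n_gt0 : (0 < n)%N) (m_gt0 : (0 < m)%N)
    (L_gt0 : 0 < L) (G_gt0 : 0 < G) (csigma_gt0 : 0 < csigma)
    (Gamma_gt0 : 0 < Gamma) (Gamma_ge : m%:R <= Gamma) :
  exists C0 C1 C2 C3 C4 C5 : R,
  forall (f : 'I_n -> 'cV[R]_d -> R) (T : nat) (eta : R)
      (delta : nat -> nat -> R)
      (B : nat -> nat -> {set 'I_n}) (x : nat -> nat -> 'cV[R]_d),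
    (1 <= T)%N ->
    0 < eta ->
    (forall k y, differentiable (f k) y) ->
    has_lbound (range (mean_fun f)) ->
    mean_fun f (x 1%N 1%N) - inf (range (mean_fun f)) = Delta ->
    (forall k y z,
      l2norm (grad (f k) y - grad (f k) z) <= L * l2norm (y - z)) ->
    (forall y, csigma ^+ 2 <=
      n%:R^-1 * \sum_(k < n)
        l2norm (grad (f k) y - grad (mean_fun f) y) ^+ 2) ->
    (forall k y, l2norm (grad (f k) y) <= G) ->
    shadagrad_run m f csigma eta Gamma delta T B x ->
    (forall t, (1 <= t <= T)%N ->
      \rank (Hmx f B x t m) = m /\
      max_singular_value ((Hmx f B x t m)^T *m Hmx f B x t m) /
      min_singular_value ((Hmx f B x t m)^T *m Hmx f B x t m) <= ckappa) ->
    eta <= csigma ^+ 2 / (16 * n%:R * L * G) ->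
    (forall i j, (1 <= i <= T)%N -> (1 <= j <= m)%N ->
      delta i j =
        \sum_(1 <= p < i) \sum_(1 <= q < m.+1)
          l2norm (step_grad f B x p q) ^+ 2
        + \sum_(1 <= q < j.+1) l2norm (step_grad f B x i q) ^+ 2) ->
    epoch_expectation T (fun t => l2norm (grad (mean_fun f) (x t 1%N))) <=
      C0 / (eta * Num.sqrt T%:R) + C1 / Num.sqrt T%:R
      + C2 * eta / Num.sqrt T%:R + C3 * eta ^+ 2 / Num.sqrt T%:R
      + C4 * ln T%:R / Num.sqrt T%:R + C5 * eta * ln T%:R / Num.sqrt T%:R.
Proof.
have [a a_def] : exists y : R, y = csigma ^+ 2 * m%:R ^+ 2 / (16 * n%:R)
  by eexists.
have [K K_def] : exists y : R, y = (1 + Gamma^-1) * (m%:R * G ^+ 2) by eexists.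
have [p p_def] : exists y : R, y = (Num.sqrt (a / (2 * Gamma)))^-1 by eexists.
have [P P_def] : exists y : R,
    y = Num.sqrt (d%:R * (K ^+ 3 / (4 * (a / (2 * Gamma)) ^+ 4)))
  by eexists.
have [b b_def] : exists y : R, y = Num.sqrt (a / ckappa) / m%:R by eexists.
have [eta0 eta0_def] : exists y : R, y = csigma ^+ 2 / (16 * n%:R * L * G)
  by eexists.
pose D := L * eta0 * m%:R * p * G.
pose c := m%:R / Num.sqrt K * b.
pose E := m%:R / Num.sqrt K * D * G + (G * p * m%:R * D + m%:R * G ^+ 2 * P)
  + L * eta0 * (m%:R * p * G) ^+ 2.
pose M := m%:R * G + L * eta0 * m%:R ^+ 2.
(* Telescoping leaves [Delta + eta M]; dividing by [eta c] gives [C0] and the [M / c] in [C1], whose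
   [G] comes from epoch 1. [E / c] multiplies the harmonic sum. The other coefficients vanish
   because surplus factors [eta] were absorbed into [eta0]. *)
exists (Delta / c), (G + M / c), 0, 0, (E / c), 0.
move=> f T eta delta B x T1 eta_gt0 df flb DeltaE lipf _ boundf run cond.
move=> eta_le deltaE.
have mR : 0 < m%:R :> R by rewrite ltr0n.
have nR : 0 < n%:R :> R by rewrite ltr0n.
have a0 : 0 < a by rewrite a_def divr_gt0 ?mulr_gt0 ?exprn_gt0.
have K0 : 0 < K.
  by rewrite K_def !mulr_gt0 ?exprn_gt0 // addr_gt0 ?invr_gt0 ?ltr01.
have p0 : 0 < p by rewrite p_def invr_gt0 sqrtr_gt0 divr_gt0 // mulr_gt0.
have P0 : 0 <= P by rewrite P_def sqrtr_ge0.
have eta00 : 0 < eta0 by rewrite eta0_def divr_gt0 ?mulr_gt0 ?exprn_gt0.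
have D0 : 0 < D by rewrite !mulr_gt0.
have T11 : (1 <= 1 <= T)%N by rewrite leqnn.
(* The witnesses contain [ckappa] before its sign is known; epoch 1 of the run forces it to be
   positive. *)
have [ck0 _] := epoch_grad_sum_ge n_gt0 m_gt0 L_gt0 G_gt0 csigma_gt0 Gamma_gt0
  eta_gt0 lipf boundf run cond eta_le a_def b_def T11.
have b0 : 0 < b by rewrite b_def divr_gt0 // sqrtr_gt0 divr_gt0.
have c0 : 0 < c by rewrite mulr_gt0 // divr_gt0 // sqrtr_gt0.
have E0 : 0 <= E.
  have q0 : 0 <= m%:R / Num.sqrt K by rewrite divr_ge0 ?sqrtr_ge0 ?ler0n.
  have [L0 G0 p0' D0'] := And4 (ltW L_gt0) (ltW G_gt0) (ltW p0) (ltW D0).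
  rewrite /E; do !rewrite addr_ge0 ?mulr_ge0 ?sqr_ge0 ?ler0n ?(ltW eta00) //.
have first_le := first_epoch_descent L_gt0 G_gt0 Gamma_gt0 eta_gt0 df lipf
  boundf run eta_le eta0_def T1.
have last_ge : inf (range (mean_fun f)) <= mean_fun f (x T.+1 1%N).
  by apply: ge_inf => //; exists (x T.+1 1%N).
(* The final value of [f] is at least its infimum, so the decrease from epoch 2 on is at most
   [Delta] plus what epoch 1 may have added. *)
have total : mean_fun f (x 2 1%N) - mean_fun f (x T.+1 1%N) <= Delta + eta * M.
  rewrite -DeltaE; move: first_le last_ge; rewrite -/M.
  move: (inf _) (mean_fun f _) (mean_fun f _) (mean_fun f _) => ? ? ? ?; lra.
have grad_le : l2norm (grad (mean_fun f) (x 1%N 1%N)) <= G.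
  by rewrite grad_mean_batch //; apply: batch_grad_le => //; exact: ltW.
have descent t (tT : (2 <= t <= T)%N) := epoch_descent n_gt0 m_gt0 L_gt0 G_gt0
  csigma_gt0 Gamma_gt0 eta_gt0 df lipf boundf run cond eta_le deltaE
  a_def K_def p_def P_def b_def eta0_def tT.
apply: le_trans (epoch_expectation_le (F := fun t => mean_fun f (x t 1%N))
  T1 eta_gt0 c0 E0 (ltW G_gt0) _ grad_le total descent) _ => [t _|].
  exact: l2norm_ge0.
have sT : 0 < Num.sqrt T%:R :> R by rewrite sqrtr_gt0 ltr0n.
rewrite le_eqVlt; apply/orP; left; apply/eqP.
by field; rewrite !gt_eqF.
Qed.
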